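(* Let $\gamma:[0,\infty)\to\mathbb{R}^{\ge0}$ be a monotone increasing function that is $O(1)$ as $t\to0$, let $f:\Pi\to\overline{\Pi}$ be analytic, and let $\tau\in\mathbb{R}$. Then $f$ is $\gamma$-regular at $\tau$ if and only if there exists a $\gamma$-augury $\Phi:\mathbb{R}^+\to\mathbb{R}^+$ such that $f$ is $\Phi$-fortunate at $\tau$.
   Context: $\Pi$ is the open upper half plane in $\mathbb{C}$, $\overline{\Pi}=\{z\in\mathbb{C}:\operatorname{Im}z\ge0\}$, and $\mathbb{R}^+=(0,\infty)$. For analytic $f:\Pi\to\overline{\Pi}$, the Nevanlinna measure $\mu_f$ is the positive Borel measure on $\mathbb{R}$ that is the weak limit (against compactly supported continuous functions) of the measures $\operatorname{Im}f(x+iy)\,dx$ as $y\to0^+$. For $\mathfrak{k}:\mathbb{R}^+\to\mathbb{R}^+$ put $\mathfrak{F}^{\mathfrak{k}}_f(z)=\operatorname{Im}f(z)/\mathfrak{k}(\operatorname{Im}z)$ and, for $\lambda:\mathbb{R}^+\to\mathbb{R}^+$ and $\varepsilon>0$, $A\mathfrak{F}^{\mathfrak{k},\tau}_{f,\lambda}(\varepsilon)=\frac{1}{2\varepsilon}\int_{-\varepsilon}^{\varepsilon}\mathfrak{F}^{\mathfrak{k}}_f(\tau+x+i\lambda(\varepsilon))\,dx$. ''$\eta$ is $O(g(t))$ as $t\to0$'' means there are $k,\delta>0$ with $\eta(t)\le kg(t)$ for all $t$ in the domain with $|t|<\delta$. $f$ is $\gamma$-regular at $\tau$ if there exists $C>0$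 such that $\frac{1}{\gamma(C|t-\tau|)}$ (with $1/0=+\infty$) is integrable on a neighborhood of $\tau$ with respect to $\mu_f$. A function $\Phi:\mathbb{R}^+\to\mathbb{R}^+$ is a $\gamma$-augury if there exists $C>0$ such that $\frac{t\,\Phi(Ct)\,d\gamma(t)}{\gamma(t)^2}$ is integrable on $[0,1)$, i.e. $\frac{t\,\Phi(Ct)}{\gamma(t)^2}$ is integrable on $[0,1)$ against $d\gamma$, where $d\gamma$ is the distributional derivative of $\gamma$. $f$ is $\Phi$-fortunate at $\tau$ if there exist $C>0$ and functions $\mathfrak{k},\lambda:\mathbb{R}^+\to\mathbb{R}^+$ such that $\Phi(Ct)=(\mathfrak{k}\circ\lambda)(t)$ for all $t>0$, $\lambda$ is $O(t)$ as $t\to0$, $\frac{\lambda(\varepsilon)}{\Phi(C\varepsilon)\varepsilon^2}$ is bounded as $\varepsilon\to0$, and $\limsup_{\varepsilon\to0}A\mathfrak{F}^{\mathfrak{k},\tau}_{f,\lambda}(\varepsilon)<\infty$.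
   Formalization: γ is assumed positive on (0,∞). In the definition of augury, γ(t)² is read as γ(t−)γ(t+), which differs only at jumps of γ; at t=0 the denominator is γ(0)γ(0+), tΦ(Ct) is replaced by its upper limit as t→0+, and dγ has mass γ(0+)−γ(0). *)

(* Defs.v *)
From HB Require Import structures.
From mathcomp Require Import all_boot all_order all_algebra.
From mathcomp Require Import all_classical all_reals all_analysis.
From mathcomp Require Import complex.

Set Implicit Arguments.
Unset Strict Implicit.
Unset Printing Implicit Defensive.

Import Order.TTheory GRing.Theory Num.Theory.
Import numFieldNormedType.Exports.

Local Open Scope classical_set_scope.
Local Open Scope complex_scope.
Local Open Scope ring_scope.

(* A function defined on (0,oo), [0,oo) or the upper half plane is represented
   by a total function whose values elsewhere are never constrained or used. *)

Definition upper_half_plane (R : realType) : set R[i] :=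
  [set z | 0 < complex.Im z].

Definition analytic_on (R : realType) (D : set R[i]) (f : R[i] -> R[i]) :=
  forall z0, D z0 -> exists (a : nat -> R[i]) (r : R), 0 < r /\
    forall z, `|z - z0| < r%:C ->
      series (fun n => a n * (z - z0) ^+ n : R[i]^o) @ \oo --> (f z : R[i]^o).

Definition maps_to_closed_half_plane (R : realType) (f : R[i] -> R[i]) :=
  forall z, upper_half_plane z -> 0 <= complex.Im (f z).

Definition pos_fun (R : realType) (h : R -> R) := forall t : R, 0 < t -> 0 < h t.

(* eta is O(g(t)) as t -> 0, for t in the common domain D of eta and g *)
Definition bigO_near0 (R : realType) (D : set R) (eta g : R -> R) :=
  exists k delta : R, [/\ 0 < k, 0 < delta &
    forall t, D t -> `|t| < delta -> eta t <= k * g t].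

(* The measure mu is locally finite and Im f(x + iy) dx converges to it, as
   y -> 0+, against continuous compactly supported functions; these properties
   determine mu. There is no factor 1/pi. *)
Definition nevanlinna_measure (R : realType) (f : R[i] -> R[i])
    (mu : {measure set (measurableTypeR R) -> \bar R}) :=
  (forall K : set R, compact K -> (mu K < +oo)%E) /\
  forall phi : R -> R, continuous phi ->
    (exists2 K : set R, compact K & forall x, ~ K x -> phi x = 0) ->
    \int[lebesgue_measure]_x (phi x * complex.Im (f (x +i* y)))
      @[y --> 0^'+] --> \int[mu]_x (phi x).

(* The inverse is that of \bar R, for which 0^-1 = +oo. *)
Definition gamma_regular (R : realType)
    (mu : {measure set (measurableTypeR R) -> \bar R}) (gamma : R -> R)
    (tau : R) :=
  exists2 C : R, 0 < C & exists2 U : set R, open_nbhs tau U &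
    mu.-integrable U (fun t => ((gamma (C * `|t - tau|))%:E^-1)%E).

Definition nondecreasing_on_nneg (R : realType) (gamma : R -> R) :=
  forall s t : R, 0 <= s -> s <= t -> gamma s <= gamma t.

Section distributional_derivative.
Context {R : realType}.
Implicit Type gamma : R -> R.

(* gamma is continued to the negative half line by gamma 0, so that d gamma
   has mass gamma(0+) - gamma(0) at 0. *)
Definition ext0 gamma (t : R) : R := gamma (Num.max t 0).

Definition left_val gamma (t : R) : R := lim (ext0 gamma x @[x --> t^'-]).

Definition right_val gamma (t : R) : R := lim (ext0 gamma x @[x --> t^'+]).

Variables (gamma : R -> R) (gamma_nd : nondecreasing_on_nneg gamma).

Lemma ext0_homo : {homo ext0 gamma : s t / s <= t}.
Proof.
move=> s t st; apply: gamma_nd; first by rewrite le_max lexx orbT.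
by rewrite ge_max !le_max st lexx !orbT.
Qed.

Lemma is_cvg_right_val t : cvg (ext0 gamma x @[x --> t^'+]).
Proof.
apply: (@nondecreasing_at_right_is_cvgr R (ext0 gamma) t).
  by near=> b => x y _ _ /ext0_homo.
near=> b; exists (ext0 gamma t) => _ [x /= xt <-].
by apply: ext0_homo; move: xt; rewrite in_itv/= => /andP[/ltW].
Unshelve. all: by end_near. Qed.

Lemma ext0_le_right_val t : ext0 gamma t <= right_val gamma t.
Proof.
rewrite /right_val; apply: (limr_ge (@is_cvg_right_val t)); near=> x; apply: ext0_homo.
exact: ltW.
Unshelve. all: by end_near. Qed.

Lemma right_val_le_ext0 s t : s < t -> right_val gamma s <= ext0 gamma t.
Proof.
move=> st; rewrite /right_val; apply: (limr_le (@is_cvg_right_val s)).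
near=> x; apply: ext0_homo; apply: ltW.
by near: x; apply: nbhs_right_lt.
Unshelve. all: by end_near. Qed.

Lemma right_val_nondecreasing : nondecreasing (right_val gamma).
Proof.
move=> s t; rewrite le_eqVlt => /predU1P[->//|st].
exact: le_trans (right_val_le_ext0 st) (ext0_le_right_val t).
Qed.

Lemma right_val_right_continuous : right_continuous (right_val gamma).
Proof.
move=> t; apply/cvgrPdist_le => e e0.
have /cvgrPdist_le/(_ _ e0)[d /= d0 H] := @is_cvg_right_val t.
near=> x; have tx : t < x by [].
have xd : x < t + d by near: x; apply: nbhs_right_lt; rewrite ltrDl.
pose y := (x + (t + d)) / 2.
have xy : x < y by rewrite midf_lt.
have yd : y < t + d by rewrite midf_lt.
have ty := lt_trans tx xy.
have ybd : ball_ [eta Num.norm] t d y.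
  by rewrite /= distrC gtr0_norm ?subr_gt0// ltrBlDl.
have := H y ybd ty; rewrite -/(right_val gamma t).
apply: le_trans; rewrite !ler0_norm ?subr_le0; first last.
- exact: right_val_nondecreasing (ltW tx).
- exact: right_val_le_ext0.
- by rewrite !opprB lerD2r right_val_le_ext0.
Unshelve. all: by end_near. Qed.

Definition stieltjes_fun of nondecreasing_on_nneg gamma := right_val gamma.

HB.instance Definition _ :=
  isCumulative.Build R _ R (stieltjes_fun gamma_nd) right_val_nondecreasing right_val_right_continuous.

(* The distributional derivative of a monotone function is its
   Lebesgue-Stieltjes measure. *)
Definition dmeasure : {measure set (measurableTypeR R) -> \bar R} :=
  lebesgue_stieltjes_measure (stieltjes_fun gamma_nd).

End distributional_derivative.

(* The map t |-> t Phi(C t); at t = 0, where Phi is not defined, its value is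
   taken as the upper limit. That value matters only if gamma jumps at 0. *)
Definition scaled_augury (R : realType) (Phi : R -> R) (C t : R) : \bar R :=
  if t == 0 then limf_esup (fun s : R => (s * Phi (C * s))%:E) 0^'+
  else (t * Phi (C * t))%:E.

(* Where gamma is continuous, gamma(t-) gamma(t+) is gamma(t)^2. At a jump the
   quotient d gamma / gamma^2 does not see the value gamma(t), since d gamma
   depends only on the one-sided limits of gamma; with the product
   gamma(t-) gamma(t+) the quotient is the derivative of - 1/gamma. *)
Definition gamma_augury (R : realType) (gamma : R -> R)
    (gamma_nd : nondecreasing_on_nneg gamma) (Phi : R -> R) :=
  exists2 C : R, 0 < C &
    (dmeasure gamma_nd).-integrable `[0, 1[%classic
      (fun t => (scaled_augury Phi C t *
                 (left_val gamma t * right_val gamma t)%:E^-1)%E).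

Definition fk (R : realType) (f : R[i] -> R[i]) (k : R -> R) (z : R[i]) : R :=
  complex.Im (f z) / k (complex.Im z).

Definition Afk (R : realType) (f : R[i] -> R[i]) (k lambda : R -> R)
    (tau e : R) : R :=
  (2 * e)^-1 *
  \int[lebesgue_measure]_(x in `[- e, e]) fk f k ((tau + x) +i* lambda e).

Definition fortunate (R : realType) (f : R[i] -> R[i]) (Phi : R -> R)
    (tau : R) :=
  exists (C : R) (k lambda : R -> R),
    [/\ 0 < C, pos_fun k & pos_fun lambda] /\
    [/\ forall t : R, 0 < t -> Phi (C * t) = k (lambda t),
        bigO_near0 [set t : R | 0 < t] lambda (fun t => t),
        bigO_near0 [set t : R | 0 < t]
          (fun e => lambda e / (Phi (C * e) * e ^+ 2)) (fun=> 1) &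
        (limf_esup (fun e => (Afk f k lambda tau e)%:E) 0^'+ < +oo)%E].

(* Main.v *)
Require Import Defs.
From HB Require Import structures.
From mathcomp Require Import all_boot all_order all_algebra.
From mathcomp Require Import all_classical all_reals all_analysis.
From mathcomp Require Import measurable_realfun.
From mathcomp Require Import complex.
From mathcomp Require Import ring lra.
Set Implicit Arguments.
Unset Strict Implicit.
Unset Printing Implicit Defensive.
Import Order.TTheory GRing.Theory Num.Theory.
Import numFieldNormedType.Exports.
Local Open Scope classical_set_scope.
Local Open Scope complex_scope.
Local Open Scope ring_scope.

(** Write [m t] for the [mu]-mass of the closed interval of radius [t] around [tau]. Both
    conditions of the theorem are statements about [m].

    Fortunate functions. If [u = Im f] is averaged over a segment of half-width [e] against
    the cosine that vanishes at its ends, the average [F y] at height [y] satisfies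
    [F'' <= om^2 F] with [om = pi / (2 e)], because [u] is harmonic and nonnegative at the
    ends. A nonnegative [F] on a half-line with this property has [exp (om y) F y]
    nondecreasing ([exp_mul_nondecreasing]). As [y] tends to [0], [F y] tends to the
    integral of the cosine bump against [mu], so at heights [lambda e = O(e)] the average of
    [u] bounds [m (e / 2)] from above: this replaces the Poisson representation. Hence
    [m (e / 2) <= M e Phi (C e)] for a fortunate function and small [e]
    ([fortunate_mass_bound]). Conversely, at sufficiently small heights the average of [u]
    over the segment is at most twice [m (2 e)] plus any prescribed positive amount
    ([horizontal_integral_le_centered_mass]).

    Reciprocals of [gamma]. The measure [d gamma / (gamma (t-) gamma (t+))] is, up to a factor
    of two, the derivative of [- 1 / gamma]: the jumps contribute exactly, and between jumps
    the interval is cut each time [gamma] has doubled ([comparable_itvco]). So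
    [1 / gamma (c |x - tau|)] is comparable to the integral of this density from
    [c |x - tau|] on. Integrating in [x] against [mu] and exchanging the integrals
    ([layer_cake]) gives the integral of [m (t / c)] against the density.

    For a fortunate function the augury therefore makes [1 / gamma] integrable
    ([regular_of_mass_bound]). For a regular function, [t Phi t] is chosen as [m t] plus a
    small correction: the exchange of integrals makes [Phi] an augury
    ([augury_of_integrable]), and the heights [lambda e] are chosen so small that the
    averages are bounded, and with [lambda] injective, which makes [Phi (2 e)] a function of
    [lambda e] ([fortunate_of_correction]). *)

(** * Strict differentiability of power series *)

Lemma norm_subrX_le (K : numFieldType) (z w d : K) n :
  `|z| <= d -> `|w| <= d ->
  `|w ^+ n.+1 - z ^+ n.+1| <= `|w - z| * (n.+1%:R * d ^+ n).
Proof.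
move=> zd wd; rewrite subrXX normrM ler_wpM2l//.
apply: le_trans (ler_norm_sum _ _ _) _.
rewrite mulr_natl -[X in _ *+ X](card_ord n.+1) -sumr_const.
apply: ler_sum => i _; rewrite normrM !normrX.
have -> : d ^+ n = d ^+ (n.+1 - i.+1) * d ^+ i.
  by rewrite -exprD subSS subnK// -ltnS.
by apply: ler_pM; rewrite ?exprn_ge0//; apply: lerXn2r; rewrite ?nnegrE// (le_trans _ zd).
Qed.

Lemma sum_half_pow_le (K : numFieldType) N : \sum_(i < N) (2%:R ^- i : K) <= 2.
Proof.
have -> : \sum_(i < N) (2%:R ^- i : K) = 2 - 2 * 2 ^- N.
  elim: N => [|N IH]; first by rewrite big_ord0 expr0 invr1 mulr1 subrr.
  rewrite big_ord_recr/= IH exprS invfM mulrA mulfV ?pnatr_eq0// mul1r; ring.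
by rewrite gerBl mulr_ge0// invr_ge0 exprn_ge0.
Qed.

(** Each difference [w ^+ n - z ^+ n] contains the factor [w - z]; what remains is at most
    [n d ^ (n - 1)], and for [d <= rho / 4] the sum over [n >= 2] is dominated by a geometric
    series times [d]. *)
Lemma power_sum_strict_diff (K : numFieldType) (a : nat -> K) (M rho d z w : K) N :
  0 < rho -> 0 <= d -> d * 4 <= rho -> (forall n, `|a n| * rho ^+ n <= M) ->
  `|z| <= d -> `|w| <= d ->
  `|\sum_(n < N.+2) a n * w ^+ n - \sum_(n < N.+2) a n * z ^+ n - a 1%N * (w - z)|
    <= 4 * M / rho ^+ 2 * d * `|w - z|.
Proof.
move=> rho0 d0 drho aM zd wd.
have M0 : 0 <= M by apply: le_trans (aM 0%N); rewrite mulr_ge0// exprn_ge0// ltW.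
have -> : \sum_(n < N.+2) a n * w ^+ n - \sum_(n < N.+2) a n * z ^+ n - a 1%N * (w - z)
  = \sum_(n < N) a n.+2 * (w ^+ n.+2 - z ^+ n.+2).
  rewrite -sumrB !big_ord_recl/= !expr0 subrr add0r -mulrBr !expr1 addrAC subrr add0r.
  by apply: eq_bigr => i _; rewrite -mulrBr.
apply: le_trans (ler_norm_sum _ _ _) _.
set T := `|w - z| * M * d / rho ^+ 2 * 2.
have T0 : 0 <= T.
  by rewrite /T mulr_ge0// mulr_ge0// ?invr_ge0 ?exprn_ge0 ?(ltW rho0)// mulr_ge0// mulr_ge0.
suff H (i : 'I_N) : true -> `|a i.+2 * (w ^+ i.+2 - z ^+ i.+2)| <= T * 2 ^- i.
  apply: le_trans (ler_sum _ H) _.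
  rewrite -mulr_sumr; apply: le_trans (ler_wpM2l T0 (sum_half_pow_le _ _)) _.
  by rewrite /T le_eqVlt; apply/orP; left; apply/eqP; ring.
move=> _; rewrite normrM.
have aM' : `|a i.+2| <= M / rho ^+ i.+2 by rewrite ler_pdivlMr ?exprn_gt0.
apply: le_trans (ler_pM _ _ aM' (norm_subrX_le _ zd wd)) _ => //.
have rd : d ^+ i.+1 <= d * (rho ^+ i * 4 ^- i).
  rewrite exprS ler_wpM2l// ler_pdivlMr ?exprn_gt0// -exprMn.
  by apply: lerXn2r; rewrite ?nnegrE ?mulr_ge0// ltW.
have n2 : i.+2%:R <= (2 * 2 ^+ i : K).
  by rewrite -natrX -natrM ler_nat -expnS; apply: ltn_expl.
apply: (@le_trans _ _ (M / rho ^+ i.+2 * (`|w - z| * (2 * 2 ^+ i * (d * (rho ^+ i * 4 ^- i)))))).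
  rewrite ler_wpM2l ?mulr_ge0 ?invr_ge0 ?exprn_ge0 ?(ltW rho0)//.
  by rewrite ler_wpM2l//; apply: ler_pM => //; rewrite exprn_ge0.
rewrite le_eqVlt; apply/orP; left; apply/eqP.
rewrite /T !exprS (_ : 4 = 2 * 2 :> K); last by rewrite -natrM.
rewrite exprMn.
have r0 : rho != 0 by rewrite gt_eqF.
have ri0 : rho ^+ i != 0 by rewrite expf_neq0.
have t0 : (2 : K) != 0 by rewrite pnatr_eq0.
have ti0 : (2 : K) ^+ i != 0 by rewrite expf_neq0.
by field; rewrite ?r0 ?ri0 ?ti0.
Qed.

Notation normc := Normc.normc.

Section normc_facts.
Context {R : realType}.
Implicit Types z w : R[i].

Lemma normcE z : `|z| = (normc z)%:C. Proof. by case: z. Qed.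

Lemma norm_Re_le z : `|complex.Re z| <= normc z.
Proof.
case: z => a b /=; rewrite -sqrtr_sqr ler_wsqrtr// lerDl sqr_ge0//.
Qed.

Lemma norm_Im_le z : `|complex.Im z| <= normc z.
Proof.
case: z => a b /=; rewrite -sqrtr_sqr ler_wsqrtr// lerDr sqr_ge0//.
Qed.

Lemma normc_ge0 z : 0 <= normc z.
Proof. by rewrite -ler0c -normcE. Qed.

Lemma normc_real (x : R) : normc x%:C = `|x|.
Proof. by rewrite /= expr0n addr0 sqrtr_sqr. Qed.

End normc_facts.

Section power_series.
Context {R : realType}.

Lemma cvg_power_series_coef_bounded (a : nat -> R[i]) (w l : R[i]) :
  series (fun n => a n * w ^+ n : R[i]^o) @ \oo --> (l : R[i]^o) ->
  exists M : R, forall n, `|a n * w ^+ n| <= M%:C.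
Proof.
move=> /cvgrPdist_lt/(_ 1 ltr01)[N _ HN].
pose S := series (fun n => a n * w ^+ n : R[i]^o).
exists (2 + \sum_(i < N) normc (a i * w ^+ i)) => n.
rewrite normcE lecR; have [nN|nN] := ltnP n N.
  apply: (@le_trans _ _ (\sum_(i < N) normc (a i * w ^+ i))); last by rewrite lerDr.
  rewrite (bigD1 (Ordinal nN))//= lerDl sumr_ge0// => i _; exact: normc_ge0.
apply: (@le_trans _ _ 2); last by rewrite lerDl sumr_ge0// => i _; exact: normc_ge0.
rewrite -lecR -normcE.
have -> : a n * w ^+ n = (l - S n) - (l - S n.+1).
  by rewrite /S !seriesEnat/= big_nat_recr//=; ring.
have h1 : `|l - S n| <= 1 by apply/ltW/HN.
have h2 : `|l - S n.+1| <= 1 by apply/ltW/HN => /=; apply: leqW.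
apply: le_trans (ler_normB _ _) _.
apply: le_trans (lerD h1 h2) _.
by rewrite -rmorphD.
Qed.

(** The bound for partial sums does not depend on their length, so it passes to the
    limit. *)
Lemma power_series_strict_diff (a : nat -> R[i]) (z0 : R[i]) (r : R) (f : R[i] -> R[i]) :
  0 < r ->
  (forall z, `|z - z0| < r%:C ->
      series (fun n => a n * (z - z0) ^+ n : R[i]^o) @ \oo --> (f z : R[i]^o)) ->
  exists s K : R, [/\ 0 < s, 0 <= K & forall (d : R) z w, d <= s ->
    normc (z - z0) <= d -> normc (w - z0) <= d ->
    normc (f w - f z - a 1%N * (w - z)) <= K * d * normc (w - z)].
Proof.
move=> r0 fa; have [rho rho0 rhor] : exists2 rho, 0 < rho & rho < r.
  by exists (r / 2); [rewrite divr_gt0|rewrite ltr_pdivrMr// ltr_pMr// ltr1n].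
have [M aM] : exists M : R, forall n, `|a n * (rho%:C) ^+ n| <= M%:C.
  apply: (@cvg_power_series_coef_bounded a rho%:C (f (z0 + rho%:C))).
  have zr : z0 + rho%:C - z0 = rho%:C by ring.
  have zr' : `|z0 + rho%:C - z0| < r%:C; last by have := fa _ zr'; rewrite zr.
  by rewrite zr normcE normc_real ltcR gtr0_norm.
have {}aM n : `|a n| * rho%:C ^+ n <= M%:C.
  have rhoC : `|rho%:C| = rho%:C by rewrite ger0_norm// ler0c ltW.
  by have := aM n; rewrite normrM normrX rhoC.
have M0 : 0 <= M.
  by rewrite -ler0c; apply: le_trans (aM 0%N); rewrite expr0 mulr1.
exists (rho / 4), (4 * M / rho ^+ 2); split.
- by rewrite divr_gt0.
- by rewrite !mulr_ge0// invr_ge0 exprn_ge0// ltW.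
move=> d z w ds zd wd.
have d0 : 0 <= d by apply: le_trans zd; exact: normc_ge0.
have small x : normc (x - z0) <= d -> `|x - z0| < r%:C.
  move=> xd; rewrite normcE ltcR; apply: (le_lt_trans xd); apply: (le_lt_trans ds).
  by apply: le_lt_trans rhor; rewrite ler_pdivrMr// ler_pMr// ler1n.
have wf := fa _ (small _ wd).
have zf := fa _ (small _ zd).
rewrite -lecR -normcE.
apply/ler_addgt0Pr => e e0.
have e20 : 0 < e / 2 by rewrite divr_gt0.
move/cvgrPdist_lt/(_ _ e20) : wf => wf.
move/cvgrPdist_lt/(_ _ e20) : zf => zf.
case: wf => N1 _ H1; case: zf => N2 _ H2; pose N := maxn N1 N2.
have wN : `|f w - series (fun n => a n * (w - z0) ^+ n : R[i]^o) N.+2| < e / 2.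
  by apply: H1; rewrite /= -addn2 (leq_trans (leq_maxl _ N2))// leq_addr.
have zN : `|f z - series (fun n => a n * (z - z0) ^+ n : R[i]^o) N.+2| < e / 2.
  by apply: H2; rewrite /= -addn2 (leq_trans (leq_maxr N1 _))// leq_addr.
set Sw := series _ _ in wN; set Sz := series _ _ in zN.
have -> : f w - f z - a 1%N * (w - z) =
  (Sw - Sz - a 1%N * (w - z)) + ((f w - Sw) - (f z - Sz)) by ring.
apply: le_trans (ler_normD _ _) _; apply: lerD; last first.
  apply: le_trans (ler_normB _ _) _.
  by apply: le_trans (lerD (ltW wN) (ltW zN)) _; rewrite -splitr.
have -> : w - z = (w - z0) - (z - z0) by ring.
rewrite /Sw /Sz !seriesEnat/= !big_mkord.
have rhoC0 : 0 < rho%:C by rewrite -[0]/(0%:C) ltcR.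
have dC0 : 0 <= d%:C by rewrite ler0c.
have d4 : d%:C * 4 <= rho%:C.
  have -> : d%:C * 4 = (d * 4)%:C by rewrite rmorphM rmorph_nat.
  by rewrite lecR -ler_pdivlMr.
have zC : `|z - z0| <= d%:C by rewrite normcE lecR.
have wC : `|w - z0| <= d%:C by rewrite normcE lecR.
apply: le_trans (power_sum_strict_diff N rhoC0 dC0 d4 aM zC wC) _.
rewrite (_ : w - z0 - (z - z0) = w - z); last by ring.
have -> : (4 * M / rho ^+ 2 * d * normc (w - z))%:C =
    4 * M%:C / rho%:C ^+ 2 * d%:C * (normc (w - z))%:C.
  by rewrite !rmorphM/= fmorphV rmorphXn rmorph_nat.
by rewrite normcE.
Qed.

End power_series.

(** Differentiability is recorded in the strict sense: it holds uniformly over pairs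
    of points near [z0], which is what makes the derivative continuous. *)
Definition strict_derivative (R : realType) (f : R[i] -> R[i]) (z0 d : R[i]) :=
  exists s K : R, [/\ 0 < s, 0 <= K & forall (e : R) z w, e <= s ->
    normc (z - z0) <= e -> normc (w - z0) <= e ->
    normc (f w - f z - d * (w - z)) <= K * e * normc (w - z)].

Lemma analytic_strict_derivative (R : realType) (D : set R[i]) (f : R[i] -> R[i]) :
  analytic_on D f -> exists d : R[i] -> R[i],
    forall z, D z -> strict_derivative f z (d z).
Proof.
move=> fD; suff /boolp.choice[d Hd] : forall z, exists d, D z -> strict_derivative f z d.
  by exists d.
move=> z; have [Dz|nDz] := pselect (D z); last by exists 0.
have [a [r [r0 fa]]] := fD _ Dz.
exists (a 1%N) => _; exact: power_series_strict_diff r0 fa.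
Qed.

(** Comparing the strict estimates at [z0] and at [z] along ever shorter increments
    bounds the difference of the two derivatives. *)
Lemma strict_derivative_lipschitz (R : realType) (f : R[i] -> R[i]) (z0 d0 : R[i]) :
  strict_derivative f z0 d0 ->
  exists s K : R, [/\ 0 < s, 0 <= K & forall z d, normc (z - z0) <= s ->
    strict_derivative f z d -> normc (d - d0) <= K * normc (z - z0)].
Proof.
move=> [s [K [s0 K0 H0]]]; exists (s / 2), K; split=> //; first by rewrite divr_gt0.
move=> z d zs [t [L [t0 L0 H]]]; set e := normc (z - z0).
apply/ler_addgt0Pr => eta eta0.
pose h := Num.min (Num.min (s / 2) t) (eta / (K + L + 1)).
have KL : 0 < K + L + 1 by rewrite ltr_wpDl// addr_ge0.
have h0 : 0 < h by rewrite !lt_min t0 !divr_gt0.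
have hs : h <= s / 2 by rewrite /h !ge_min lexx.
have ht : h <= t by rewrite /h !ge_min lexx orbT.
have he : h * (K + L + 1) <= eta by rewrite -ler_pdivlMr// /h !ge_min lexx !orbT.
have hn : normc (h%:C) = h by rewrite normc_real gtr0_norm.
pose w := z + h%:C.
have wz : w - z = h%:C by rewrite /w; ring.
have e0 : 0 <= e := normc_ge0 _.
have A : normc (f w - f z - d0 * (w - z)) <= K * (e + h) * h.
  have -> : K * (e + h) * h = K * (e + h) * normc (w - z) by rewrite wz hn.
  apply: H0.
  - by rewrite (splitr s) lerD.
  - by rewrite lerDl ltW.
  - rewrite (_ : w - z0 = (z - z0) + h%:C); last by rewrite /w; ring.
    by apply: le_trans (le_normcD _ _) _; rewrite hn.
have B : normc (f w - f z - d * (w - z)) <= L * h * h.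
  have -> : L * h * h = L * h * normc (w - z) by rewrite wz hn.
  apply: H => //; last by rewrite wz hn.
  by rewrite subrr -[0]/(0%:C) normc_real normr0 ltW.
have C : normc (d - d0) * h <= K * (e + h) * h + L * h * h.
  have -> : normc (d - d0) * h = normc ((d - d0) * h%:C) by rewrite Normc.normcM hn.
  have -> : (d - d0) * h%:C = (f w - f z - d0 * (w - z)) - (f w - f z - d * (w - z)).
    by rewrite wz; ring.
  by apply: le_trans (le_normcD _ _) _; rewrite normcN lerD.
have {}C : normc (d - d0) <= K * (e + h) + L * h.
  by rewrite -(ler_pM2r h0) mulrDl.
apply: le_trans C _; rewrite mulrDr -addrA lerD2l -mulrDl mulrC.
by apply: le_trans he; rewrite ler_wpM2l ?(ltW h0)// lerDl.
Qed.

(** * Partial derivatives in real coordinates *)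

Lemma is_derive_of_quadratic_error (R : realType) (g : R -> R) (x l C r : R) :
  0 < r -> 0 <= C ->
  (forall h, `|h| <= r -> `|g (h + x) - g x - l * h| <= C * `|h| * `|h|) ->
  is_derive x 1 g l.
Proof.
move=> r0 C0 H.
have cv : h^-1 *: (g (h *: 1 + x) - g x) @[h --> 0^'] --> l.
  apply/cvgrPdist_le => e e0; near=> h.
  have h0 : h != 0 by near: h; exact: nbhs_dnbhs_neq.
  have hr : `|h| <= r by near: h; apply: dnbhs0_le.
  have he : `|h| <= e / (C + 1) by near: h; apply: dnbhs0_le; rewrite divr_gt0// ltr_wpDl.
  rewrite /GRing.scale/= mulr1 -(ler_pM2r (_ : 0 < `|h|)) ?normr_gt0// -normrM.
  have -> : (l - h^-1 * (g (h + x) - g x)) * h = - (g (h + x) - g x - l * h) by field.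
  rewrite normrN; apply: le_trans (H _ hr) _; rewrite ler_wpM2r//.
  apply: (@le_trans _ _ ((C + 1) * `|h|)); first by rewrite ler_wpM2r// lerDl.
  by rewrite mulrC -ler_pdivlMr// ltr_wpDl.
apply: DeriveDef; first by apply/cvg_ex; exists l.
by apply/cvg_lim.
Unshelve. all: by end_near. Qed.

Section real_coordinates.
Context {R : realType}.
Implicit Types (f : R[i] -> R[i]) (x y : R).

Lemma normc_pure_im (h : R) : normc (0 +i* h) = `|h|.
Proof. by rewrite /= expr0n add0r sqrtr_sqr. Qed.

Lemma normc_le_sum (a b : R) : normc (a +i* b) <= `|a| + `|b|.
Proof.
have -> : a +i* b = a%:C + (0 +i* b) by simpc.
by apply: le_trans (le_normcD _ _) _; rewrite normc_real normc_pure_im.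
Qed.

Section at_a_point.
Variables (f : R[i] -> R[i]) (x y : R) (d : R[i]).
Hypothesis fd : strict_derivative f (x +i* y) d.

(** The four partial derivatives of the real and imaginary parts of [f] are the instances
    [w = 1] and [w = i] with [phi] a coordinate. *)
Lemma derive_along (w : R[i]) (phi : R[i] -> R) (g : R -> R) :
  (forall a b, phi (a - b) = phi a - phi b) -> (forall a, `|phi a| <= normc a) ->
  (forall h : R, normc (h%:C * w) = `|h|) ->
  (forall (h : R) a, phi (a * h%:C) = phi a * h) ->
  forall t, (forall h, g (h + t) = phi (f (x +i* y + h%:C * w))) ->
  is_derive t 1 g (phi (d * w)).
Proof.
move=> phiB phi_le w1 phiZ t gE.
have [s [K [s0 K0 H]]] := fd.
apply: (is_derive_of_quadratic_error s0 K0) => h hs.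
have -> : g t = phi (f (x +i* y)).
  by have := gE 0; rewrite add0r => ->; rewrite rmorph0 mul0r addr0.
rewrite gE -phiB -phiZ -phiB.
apply: le_trans (phi_le _) _.
set z := x +i* y; set w' := z + _.
have wz : w' - z = h%:C * w by rewrite /w'; ring.
have -> : d * w * h%:C = d * (w' - z) by rewrite wz; ring.
have -> : K * `|h| * `|h| = K * `|h| * normc (w' - z) by rewrite wz w1.
by apply: H => //; rewrite ?wz ?w1// subrr -[0]/(0%:C) normc_real normr0.
Qed.

Lemma is_derive_Im_horizontal : is_derive x 1 (fun t => complex.Im (f (t +i* y))) (complex.Im d).
Proof.
rewrite -[X in complex.Im X](mulr1 d); apply: derive_along.
- by move=> [? ?] [? ?].
- exact: norm_Im_le.
- by move=> h; rewrite mulr1 normc_real.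
- by move=> h [a b] /=; ring.
- by move=> h; rewrite mulr1; congr (complex.Im (f _)); simpc; rewrite addrC.
Qed.

Lemma is_derive_Re_horizontal : is_derive x 1 (fun t => complex.Re (f (t +i* y))) (complex.Re d).
Proof.
rewrite -[X in complex.Re X](mulr1 d); apply: derive_along.
- by move=> [? ?] [? ?].
- exact: norm_Re_le.
- by move=> h; rewrite mulr1 normc_real.
- by move=> h [a b] /=; ring.
- by move=> h; rewrite mulr1; congr (complex.Re (f _)); simpc; rewrite addrC.
Qed.

Lemma is_derive_Im_vertical : is_derive y 1 (fun t => complex.Im (f (x +i* t))) (complex.Re d).
Proof.
have -> : complex.Re d = complex.Im (d * (0 +i* 1)).
  by case: d => a b /=; ring.
apply: derive_along.
- by move=> [? ?] [? ?].
- exact: norm_Im_le.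
- move=> h; rewrite (_ : _ * _ = 0 +i* h) ?normc_pure_im//.
  by apply/eqP; rewrite eq_complex/=; apply/andP; split; apply/eqP; ring.
- by move=> h [a b] /=; ring.
- move=> h; congr (complex.Im (f _)).
  by apply/eqP; rewrite eq_complex/=; apply/andP; split; apply/eqP; ring.
Qed.

Lemma is_derive_Re_vertical : is_derive y 1 (fun t => complex.Re (f (x +i* t))) (- complex.Im d).
Proof.
have -> : - complex.Im d = complex.Re (d * (0 +i* 1)).
  by case: d => a b /=; ring.
apply: derive_along.
- by move=> [? ?] [? ?].
- exact: norm_Re_le.
- move=> h; rewrite (_ : _ * _ = 0 +i* h) ?normc_pure_im//.
  by apply/eqP; rewrite eq_complex/=; apply/andP; split; apply/eqP; ring.
- by move=> h [a b] /=; ring.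
- move=> h; congr (complex.Re (f _)).
  by apply/eqP; rewrite eq_complex/=; apply/andP; split; apply/eqP; ring.
Qed.

End at_a_point.

Lemma continuous_derivative_coordinate f (d : R[i] -> R[i]) (phi : R[i] -> R) (x y : R) :
  (forall a b, phi (a - b) = phi a - phi b) -> (forall a, `|phi a| <= normc a) ->
  (forall z, upper_half_plane z -> strict_derivative f z (d z)) -> 0 < y ->
  {for (x, y), continuous (fun t : R * R => phi (d (t.1 +i* t.2)))}.
Proof.
move=> phiB phi_le fd y0.
have [s [K [s0 K0 H]]] := strict_derivative_lipschitz (fd (x +i* y) y0).
apply/cvgrPdist_le => e e0.
pose r := Num.min (Num.min s (e / (K + 1))) y / 2.
have K1 : 0 < K + 1 by rewrite ltr_wpDl.
have r0 : 0 < r by rewrite divr_gt0// !lt_min s0 y0 divr_gt0.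
near=> t.
have t1 : `|x - t.1| < r.
  near: t; exists (ball x r, ball y r); first by split; exact: nbhsx_ballx.
  by move=> [a b] [/=].
have t2 : `|y - t.2| < r.
  near: t; exists (ball x r, ball y r); first by split; exact: nbhsx_ballx.
  by move=> [a b] [/=].
have rr : r + r = Num.min (Num.min s (e / (K + 1))) y by rewrite /r -splitr.
have rs : r + r <= s by rewrite rr !ge_min lexx.
have re : (r + r) * (K + 1) <= e by rewrite -ler_pdivlMr// rr !ge_min lexx orbT.
have ry : r + r <= y by rewrite rr !ge_min lexx !orbT.
have t20 : 0 < t.2.
  have : y - t.2 < r by apply: le_lt_trans t2; exact: ler_norm.
  by lra.
have tz : normc (t.1 +i* t.2 - x +i* y) <= r + r.
  have -> : t.1 +i* t.2 - x +i* y = (t.1 - x) +i* (t.2 - y) by simpc.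
  by apply: le_trans (normc_le_sum _ _) _; rewrite !(distrC t.1) !(distrC t.2) lerD// ltW.
rewrite distrC -phiB; apply: le_trans (phi_le _) _ => /=.
have tU : upper_half_plane (t.1 +i* t.2) by [].
apply: le_trans (H _ _ (le_trans tz rs) (fd _ tU)) _.
apply: le_trans re; rewrite mulrC; apply: ler_pM => //; first exact: normc_ge0.
by rewrite lerDl.
Unshelve. all: by end_near. Qed.

End real_coordinates.

(** * Calculus on the line and a differential inequality *)

Section real_calculus.
Context {R : realType}.
Local Notation leb := (@lebesgue_measure R).

Lemma is_derive_continuous (h h' : R -> R) :
  (forall x : R, is_derive x 1 h (h' x)) -> continuous h.
Proof.
by move=> H x; apply: differentiable_continuous; apply/derivable1_diffP; have [] := H x.
Qed.

Lemma continuous_integrable_segment (h : R -> R) (a b : R) :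
  continuous h -> leb.-integrable `[a, b] (EFin \o h).
Proof.
move=> ch; apply: continuous_compact_integrable; first exact: segment_compact.
exact: continuous_subspaceT.
Qed.

Lemma Rintegral_derivative (h h' : R -> R) (a b : R) : a < b ->
  (forall x : R, is_derive x 1 h (h' x)) -> continuous h' ->
  \int[leb]_(x in `[a, b]) h' x = h b - h a.
Proof.
move=> ab dh ch'; have ch := is_derive_continuous dh.
rewrite /Rintegral (@continuous_FTC2 _ h' h)//.
- exact: continuous_subspaceT.
- split; first by move=> x _; have [] := dh x.
  + by apply: cvg_at_right_filter; exact: ch.
  + by apply: cvg_at_left_filter; exact: ch.
- by move=> x _; rewrite derive1E; have [] := dh x.
Qed.

Lemma is_derive_ge0_le (h h' : R -> R) (a b : R) : a <= b ->
  (forall x : R, a <= x <= b -> is_derive x 1 h (h' x)) ->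
  (forall x, a <= x <= b -> 0 <= h' x) -> h a <= h b.
Proof.
move=> ab dh h'0; rewrite -subr_ge0.
have [||c] := @MVT_segment _ h h' a b ab.
- by move=> x /subset_itv_oo_cc; rewrite in_itv/= => /dh.
- apply: continuous_in_subspaceT => x; rewrite inE/= in_itv/= => /dh[d _].
  by apply: differentiable_continuous; apply/derivable1_diffP.
- rewrite in_itv/= => /h'0 c0 ->; rewrite mulr_ge0// subr_ge0//.
Qed.

(** This bound dominates the difference quotients in the differentiation under the
    integral sign below. *)
Lemma bounded_near_horizontal_segment (g : R -> R -> R) (a b y : R) : 0 < y ->
  (forall x s : R, 0 < s -> {for (x, s), continuous (fun t : R * R => g t.1 t.2)}) ->
  exists2 M : R, 0 <= M & forall x s : R, a <= x <= b -> y / 2 <= s <= 2 * y -> `|g x s| <= M.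
Proof.
move=> y0 cg; pose G (t : R * R) := g t.1 t.2.
have : compact (G @` (`[a, b] `*` `[y / 2, 2 * y])).
  apply: continuous_compact; last by apply: compact_setX; exact: segment_compact.
  apply: continuous_in_subspaceT => -[x s]; rewrite inE/= => -[_].
  rewrite /= in_itv/= => /andP[ys _]; apply: cg.
  by apply: lt_le_trans ys; rewrite divr_gt0.
move=> /compact_bounded[M [_ HM]].
exists (`|M| + 1); first by rewrite addr_ge0.
move=> x s xab sy; apply: HM; last by exists (x, s).
by rewrite (le_lt_trans (ler_norm _))// ltrDl.
Qed.

Lemma is_derive_Rintegral (c : R -> R) (g g' : R -> R -> R) (a b y : R) :
  continuous c -> (forall x, `|c x| <= 1) ->
  (forall s, 0 < s -> continuous (g ^~ s)) ->
  (forall x s : R, 0 < s -> is_derive s 1 (g x) (g' x s)) ->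
  (forall x s : R, 0 < s -> {for (x, s), continuous (fun t : R * R => g' t.1 t.2)}) ->
  0 < y ->
  is_derive y 1 (fun s => \int[leb]_(x in `[a, b]) (c x * g x s))
    (\int[leb]_(x in `[a, b]) (c x * g' x y)).
Proof.
move=> cc c1 cg dg cg' y0.
have [M M0 HM] := bounded_near_horizontal_segment a b y0 cg'.
pose ff s x := c x * g x s.
have dff (x s : R) : 0 < s -> is_derive s 1 (ff ^~ x) (c x * g' x s).
  by move=> s0; have dgs := dg x s s0; exact: (is_deriveZ (c x)).

have I (s : R) : `]y / 2, 2 * y[%classic s -> [/\ 0 < s & y / 2 <= s <= 2 * y].
  rewrite /= in_itv/= => /andP[s1 s2]; rewrite !ltW//; split => //.
  by apply: lt_trans s1; rewrite divr_gt0.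
have Iy : `]y / 2, 2 * y[%classic y by rewrite /= in_itv/=; apply/andP; split; lra.
have int (s : R) : `]y / 2, 2 * y[%classic s -> leb.-integrable `[a, b] (EFin \o ff s).
  move=> /I[s0 _]; apply: continuous_integrable_segment => x.
  by apply: continuousM; [exact: cc|exact: cg].
have der (s x : R) : `]y / 2, 2 * y[%classic s -> `[a, b]%classic x -> derivable (ff ^~ x) s 1.
  by move=> /I[s0 _] _; have [] := dff x s s0.
have d1 (s x : R) : 0 < s -> partial1of2 ff s x = c x * g' x s.
  by move=> s0; rewrite partial1of2E; have [] := dff x s s0.
have bd (s x : R) : `]y / 2, 2 * y[%classic s -> `[a, b]%classic x -> `|partial1of2 ff s x| <= M.
  move=> /I[s0 sy] xab; rewrite d1// normrM -[M]mul1r ler_pM//.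
  by apply: HM => //; move: xab; rewrite /= in_itv.
have intM : leb.-integrable `[a, b] (EFin \o (fun=> M)).
  by apply: continuous_integrable_segment => x; exact: cst_continuous.
have mab : measurable (`[a, b] : set R) by [].
apply: DeriveDef.
  exact: (@derivable_under_integral R _ _ leb ff _ mab y _ _ Iy int der (fun=> M) (fun=> M0) intM bd).
rewrite -derive1E.
rewrite (@differentiation_under_integral R _ _ leb ff _ mab y _ _ Iy int der (fun=> M) (fun=> M0) intM bd).
by apply: eq_Rintegral => x _; rewrite d1.
Qed.

End real_calculus.

Section differential_inequality.
Context {R : realType}.
Variables (F S w : R -> R) (om : R).
Hypothesis om0 : 0 < om.
Hypothesis dF : forall y : R, 0 < y -> is_derive y 1 F (om * S y).
Hypothesis dS : forall y : R, 0 < y -> is_derive y 1 S (om * F y - w y).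
Hypothesis F0 : forall y, 0 < y -> 0 <= F y.
Hypothesis w0 : forall y, 0 < y -> 0 <= w y.

Let dexp (k y : R) : is_derive y 1 (fun s => expR (k * s)) (k * expR (k * y)).
Proof.
apply: is_derive_eq; rewrite /GRing.scale/=. ring.
Qed.

(** [F + S] grows at most like [exp (om y)], so once negative it stays below a
    negative constant; then [exp (om y) F] decreases linearly and [F] becomes negative. *)
Let FS_ge0 (y : R) : 0 < y -> 0 <= F y + S y.
Proof.
move=> y0; rewrite leNgt; apply/negP => neg.
have below (s : R) : y <= s -> F s + S s <= F y + S y.
  move=> ys.
  have h : expR (- om * s) * (F s + S s) <= expR (- om * y) * (F y + S y).
    rewrite -lerN2.
    apply: (@is_derive_ge0_le _ (fun t => - (expR (- om * t) * (F t + S t)))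
      (fun t => expR (- om * t) * w t) y s ys) => t /andP[yt _].
      have t0 := lt_le_trans y0 yt.
      have := dF t0 => ?; have := dS t0 => ?; have := dexp (- om) t => ?.
      by apply: is_derive_eq; rewrite /GRing.scale/=; ring.
    by rewrite mulr_ge0 ?expR_ge0// w0// (lt_le_trans y0 yt).
  have e0 := expR_gt0 (- om * s).
  rewrite -(ler_pM2l e0); apply: le_trans h _.
  by rewrite ler_wnM2r ?(ltW neg)// ler_expR ler_nM2l ?oppr_lt0.
pose c := om * expR (om * y) * - (F y + S y).
have c0 : 0 < c by rewrite /c !mulr_gt0 ?expR_gt0// oppr_gt0.
have lin (s : R) : y <= s -> expR (om * s) * F s + c * s <= expR (om * y) * F y + c * y.
  move=> ys; rewrite -lerN2.
  apply: (@is_derive_ge0_le _ (fun t => - (expR (om * t) * F t + c * t))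
    (fun t => - (om * expR (om * t) * (F t + S t) + c)) y s ys) => t /andP[yt _].
    have t0 := lt_le_trans y0 yt.
    have := dF t0 => ?; have := dexp om t => ?.
    by apply: is_derive_eq; rewrite /GRing.scale/=; ring.
  rewrite oppr_ge0 /c mulrN subr_le0.
  apply: (@le_trans _ _ (om * expR (om * t) * (F y + S y))).
    by rewrite ler_wpM2l ?below// mulr_ge0 ?expR_ge0// ltW.
  by rewrite ler_wnM2r ?(ltW neg)// ler_pM2l// ler_expR ler_pM2l.
pose s := y + (expR (om * y) * F y) / c + 1.
have ys : y <= s.
  rewrite /s -addrA lerDl addr_ge0// divr_ge0 ?(ltW c0)// mulr_ge0 ?expR_ge0// F0//.
have := lin s ys.
have s0 := lt_le_trans y0 ys.
have -> : c * s = c * y + expR (om * y) * F y + c.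
  by rewrite /s; field; rewrite gt_eqF.
have : 0 <= expR (om * s) * F s by rewrite mulr_ge0 ?expR_ge0// F0.
by move: (c * y) (expR (om * s) * F s) (expR (om * y) * F y) => *; lra.
Qed.

(** Eliminating [S] gives [F'' <= om^2 F]. A nonnegative solution on a half-line cannot decay
    faster than [exp (- om y)]: one that did would become negative further up. *)
Lemma exp_mul_nondecreasing (y l : R) : 0 < y -> y <= l ->
  expR (om * y) * F y <= expR (om * l) * F l.
Proof.
move=> y0 yl.
apply: (@is_derive_ge0_le _ (fun t => expR (om * t) * F t)
  (fun t => om * expR (om * t) * (F t + S t)) y l yl) => t /andP[yt _].
  have t0 := lt_le_trans y0 yt.
  have := dF t0 => ?; have := dexp om t => ?.
  by apply: is_derive_eq; rewrite /GRing.scale/=; ring.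
rewrite mulr_ge0// ?FS_ge0 ?(lt_le_trans y0 yt)// mulr_ge0 ?expR_ge0// ltW//.
Qed.

End differential_inequality.

(** * Cosine averages of a pair of conjugate harmonic functions *)

Section cosine_averages.
Context {R : realType}.
Local Notation leb := (@lebesgue_measure R).
Variables (u v p q : R -> R -> R).
Hypothesis ux : forall x y : R, 0 < y -> is_derive x 1 (u ^~ y) (q x y).
Hypothesis vx : forall x y : R, 0 < y -> is_derive x 1 (v ^~ y) (p x y).
Hypothesis uy : forall x y : R, 0 < y -> is_derive y 1 (u x) (p x y).
Hypothesis vy : forall x y : R, 0 < y -> is_derive y 1 (v x) (- q x y).
Hypothesis cp : forall x y : R, 0 < y -> {for (x, y), continuous (fun t : R * R => p t.1 t.2)}.
Hypothesis cq : forall x y : R, 0 < y -> {for (x, y), continuous (fun t : R * R => q t.1 t.2)}.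
Hypothesis u0 : forall x y : R, 0 < y -> 0 <= u x y.
Variables (tau e : R).
Hypothesis e0 : 0 < e.

Let om := pi / 2 / e.
Let om0 : 0 < om. Proof. by rewrite !divr_gt0// pi_gt0. Qed.
Let arg x := om * (x - tau).

Let section_continuous (g : R -> R -> R) y :
  (forall x y : R, 0 < y -> {for (x, y), continuous (fun t : R * R => g t.1 t.2)}) ->
  0 < y -> continuous (g ^~ y).
Proof.
move=> cg y0 x.
by apply: (@continuous2_cvg _ _ _ _ (nbhs x) _ id (fun=> y) g) => //; [exact: cg|exact: cvg_cst].
Qed.

Let darg (x : R) : is_derive x 1 arg om.
Proof. by rewrite /arg; apply: is_derive_eq; rewrite /GRing.scale/=; ring. Qed.

Let dcos (x : R) : is_derive x 1 (fun x => cos (arg x)) (- (om * sin (arg x))).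
Proof.
have := darg x => ?.
by apply: is_derive_eq; rewrite /GRing.scale/=; ring.
Qed.

Let dsin (x : R) : is_derive x 1 (fun x => sin (arg x)) (om * cos (arg x)).
Proof.
have := darg x => ?.
by apply: is_derive_eq; rewrite /GRing.scale/=; ring.
Qed.

Let ccos : continuous (fun x => cos (arg x)). Proof. exact: is_derive_continuous dcos. Qed.
Let csin : continuous (fun x => sin (arg x)). Proof. exact: is_derive_continuous dsin. Qed.

Let argr : arg (tau + e) = pi / 2.
Proof. by rewrite /arg /om addrAC subrr add0r divfK ?gt_eqF. Qed.

Let argl : arg (tau - e) = - (pi / 2).
Proof. by rewrite /arg /om addrAC subrr add0r mulrN divfK ?gt_eqF. Qed.

Let ab : tau - e < tau + e. Proof. by rewrite ltrD2l gtrN. Qed.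

Definition cos_average y := \int[leb]_(x in `[tau - e, tau + e]) (cos (arg x) * u x y).
Definition sin_average y := \int[leb]_(x in `[tau - e, tau + e]) (sin (arg x) * v x y).

Let cu y : 0 < y -> continuous (u ^~ y).
Proof. move=> y0; apply: (is_derive_continuous (fun x => ux x y0)). Qed.
Let cv y : 0 < y -> continuous (v ^~ y).
Proof. move=> y0; apply: (is_derive_continuous (fun x => vx x y0)). Qed.

Let int_prod (c g : R -> R) : continuous c -> continuous g ->
  leb.-integrable `[tau - e, tau + e] (EFin \o (fun x => c x * g x)).
Proof.
move=> cc cg; apply: continuous_integrable_segment => x.
by apply: cvgM; [exact: cc|exact: cg].
Qed.

(** The endpoints are zeros of the cosine, so integrating [cos v] by parts leaves no
    boundary term. *)
Lemma is_derive_cos_average (y : R) : 0 < y ->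
  is_derive y 1 cos_average (om * sin_average y).
Proof.
move=> y0.
have D : is_derive y 1 cos_average (\int[leb]_(x in `[tau - e, tau + e]) (cos (arg x) * p x y)).
  have c1 x : `|cos (arg x)| <= 1 by rewrite ler_norml cos_geN1 cos_le1.
  exact: (is_derive_Rintegral _ _ ccos c1 cu uy cp y0).
suff -> : om * sin_average y = \int[leb]_(x in `[tau - e, tau + e]) (cos (arg x) * p x y) by [].
have cpy := section_continuous cp y0.
have H : \int[leb]_(x in `[tau - e, tau + e]) (cos (arg x) * p x y - om * (sin (arg x) * v x y)) = 0.
  have /(Rintegral_derivative ab) -> : forall x : R, is_derive x 1 (fun x => cos (arg x) * v x y)
      (cos (arg x) * p x y - om * (sin (arg x) * v x y)).
  - move=> x; have := dcos x => ?; have := vx x y0 => ?.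
    by apply: is_derive_eq; rewrite /GRing.scale/=; ring.
  - by rewrite argr argl cosN cos_pihalf !mul0r subrr.
  - move=> x; apply: cvgB; first by apply: cvgM; [exact: ccos|exact: cpy].
    apply: cvgM; first exact: cvg_cst.
    by apply: cvgM; [exact: csin|exact: cv].
have i1 : leb.-integrable `[tau - e, tau + e] (EFin \o (fun x => cos (arg x) * p x y)).
  exact: int_prod.
have i2 : leb.-integrable `[tau - e, tau + e] (EFin \o (fun x => sin (arg x) * v x y)).
  by apply: int_prod => //; exact: cv.
move/eqP: H; rewrite RintegralB//; last first.
  apply: continuous_integrable_segment => x.
  apply: cvgM; first exact: cvg_cst.
  by apply: cvgM; [exact: csin|exact: cv].
by rewrite RintegralZl// subr_eq0 => /eqP.
Qed.

(** At the endpoints the sine is [1] and [-1]: the boundary term is the sum of the two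
    boundary values of [u]. *)
Lemma is_derive_sin_average (y : R) : 0 < y ->
  is_derive y 1 sin_average (om * cos_average y - (u (tau + e) y + u (tau - e) y)).
Proof.
move=> y0.
have D : is_derive y 1 sin_average (\int[leb]_(x in `[tau - e, tau + e]) (sin (arg x) * - q x y)).
  have c1 x : `|sin (arg x)| <= 1 by rewrite ler_norml sin_geN1 sin_le1.
  apply: (is_derive_Rintegral _ _ csin c1 cv vy _ y0) => x s s0.
  by apply: cvgN; exact: cq.
have cqy := section_continuous cq y0.
suff -> : om * cos_average y - (u (tau + e) y + u (tau - e) y) =
    \int[leb]_(x in `[tau - e, tau + e]) (sin (arg x) * - q x y) by [].
have i1 : leb.-integrable `[tau - e, tau + e] (EFin \o (fun x => cos (arg x) * u x y)).
  by apply: int_prod => //; exact: cu.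
have i2 : leb.-integrable `[tau - e, tau + e] (EFin \o (fun x => sin (arg x) * - q x y)).
  by apply: int_prod => // x; apply: cvgN; exact: cqy.
have H : \int[leb]_(x in `[tau - e, tau + e]) (om * (cos (arg x) * u x y) - sin (arg x) * - q x y)
    = u (tau + e) y + u (tau - e) y.
  have /(Rintegral_derivative ab) -> : forall x : R, is_derive x 1 (fun x => sin (arg x) * u x y)
      (om * (cos (arg x) * u x y) - sin (arg x) * - q x y).
  - move=> x; have := dsin x => ?; have := ux x y0 => ?.
    by apply: is_derive_eq; rewrite /GRing.scale/=; ring.
  - by rewrite argr argl sinN sin_pihalf mulN1r opprK mul1r.
  - move=> x; apply: cvgB.
      apply: cvgM; first exact: cvg_cst.
      by apply: cvgM; [exact: ccos|exact: cu].
    by apply: cvgM; [exact: csin|apply: cvgN; exact: cqy].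
rewrite -H RintegralB//; last first.
  apply: continuous_integrable_segment => x.
  apply: cvgM; first exact: cvg_cst.
  by apply: cvgM; [exact: ccos|exact: cu].
by rewrite RintegralZl// opprB addrCA subrr addr0.
Qed.

Lemma cos_arg_ge0 x : tau - e <= x <= tau + e -> 0 <= cos (arg x).
Proof.
move=> /andP[h1 h2]; apply: cos_ge0_pihalf; apply/andP; split.
  by rewrite -argl /arg ler_pM2l// lerD2r.
by rewrite -argr /arg ler_pM2l// lerD2r.
Qed.

Lemma cos_average_ge0 y : 0 < y -> 0 <= cos_average y.
Proof.
move=> y0; apply: Rintegral_ge0 => x; rewrite /= in_itv/= => xab.
by rewrite mulr_ge0 ?u0// cos_arg_ge0.
Qed.

(** The boundary values of [u] at the two ends form the nonnegative term by which [F'']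
    falls short of [om^2 F]. *)
Lemma cos_average_exp_nondecreasing y l : 0 < y -> y <= l ->
  expR (om * y) * cos_average y <= expR (om * l) * cos_average l.
Proof.
apply: (exp_mul_nondecreasing om0 is_derive_cos_average is_derive_sin_average cos_average_ge0).
by move=> s s0; rewrite addr_ge0// u0.
Qed.

End cosine_averages.

(** * Horizontal integrals and the Nevanlinna measure *)

Lemma Rintegral_le_subset d (T : measurableType d) (R : realType)
    (mu : {measure set T -> \bar R}) (A B : set T) (h : T -> R) :
  measurable A -> measurable B -> mu.-integrable B (EFin \o h) ->
  (forall x, B x -> 0 <= h x) -> A `<=` B ->
  \int[mu]_(x in A) h x <= \int[mu]_(x in B) h x.
Proof.
move=> mA mB ih h0 AB; have ihA := integrableS mB mA AB ih.
rewrite /Rintegral fine_le//.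
- exact: (integrable_fin_num mA ihA).
- exact: (integrable_fin_num mB ih).
- apply: ge0_subset_integral => //; exact: measurable_int ih.
Qed.

Section translation.
Context {R : realType}.
Local Notation leb := (@lebesgue_measure R).

Lemma Rintegral_translation (g : R -> R) (tau a b : R) : a <= b -> continuous g ->
  \int[leb]_(x in `[a, b]) g (tau + x) = \int[leb]_(x in `[tau + a, tau + b]) g x.
Proof.
move=> ab cg; rewrite /Rintegral; congr fine.
have d1 (x : R) : is_derive x 1 (fun x : R => tau + x) 1.
  by apply: is_derive_eq; rewrite add0r mulr1.
have D1 : derive1 (fun x : R => tau + x) = cst 1.
  by apply/funext => x; rewrite derive1E; have [] := d1 x.
have ct : continuous (fun x : R => tau + x) := is_derive_continuous d1.
rewrite (@integration_by_substitution_increasing _ (fun x => tau + x) g)//.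
- by apply: eq_integral => x _; rewrite D1 /= fctE/= mulr1.
- by move=> x y _ _; rewrite ltrD2l.
- by rewrite D1 => x _; exact: cst_continuous.
- by rewrite D1; exact: is_cvg_cst.
- by rewrite D1; exact: is_cvg_cst.
- split; first by move=> x _; have [] := d1 x.
  + by apply: cvg_at_right_filter; exact: ct.
  + by apply: cvg_at_left_filter; exact: ct.
- exact: continuous_subspaceT.
Qed.

End translation.

Section cosine_bump.
Context {R : realType}.
Variables (tau e : R).
Hypothesis e0 : 0 < e.

(** The argument of the cosine is clamped to [-pi/2, pi/2], so the function is
    continuous and vanishes at distance at least [e] from [tau]. *)
Definition cos_bump (x : R) : R :=
  cos (Num.max (- (pi / 2)) (Num.min (pi / 2) (pi / 2 / e * (x - tau)))).

Let pi20 : 0 < pi / 2 :> R. Proof. by rewrite divr_gt0// pi_gt0. Qed.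

Lemma cos_bump_continuous : continuous cos_bump.
Proof.
have c0 : continuous (fun x : R => pi / 2 / e * (x - tau)).
  move=> x; apply: cvgM; first exact: cvg_cst.
  by apply: cvgB; [exact: cvg_id|exact: cvg_cst].
have cst_c (k : R) : continuous (fun _ : R => k) by move=> x; exact: cvg_cst.
have c x := continuous_max (@cst_c (- (pi / 2)) x) (continuous_min (@cst_c (pi / 2) x) (c0 x)).
by move=> x; exact: (continuous_comp (c x) (@continuous_cos _ _)).
Qed.

Let argE (x : R) : pi / 2 / e * (x - tau) = pi / 2 * ((x - tau) / e).
Proof. by rewrite mulrAC mulrA. Qed.

Lemma cos_bump_out (x : R) : ~ `[tau - e, tau + e]%classic x -> cos_bump x = 0.
Proof.
move=> xab; have : ~~ (x \in `[tau - e, tau + e]) by apply/negP.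
rewrite in_itv/= negb_and -!ltNge /cos_bump argE => /orP[xl|xr].
  have h : pi / 2 * ((x - tau) / e) <= - (pi / 2).
    by rewrite -[leRHS]mulrN1 ler_pM2l// ler_pdivrMr// mulN1r; lra.
  rewrite (min_idPr _) ?(max_idPl _)//; last by apply: le_trans h _; rewrite -subr_ge0 opprK addr_ge0// ltW.
  by rewrite cosN cos_pihalf.
have h : pi / 2 <= pi / 2 * ((x - tau) / e).
  by rewrite ler_pMr// ler_pdivlMr// mul1r; lra.
rewrite (min_idPl _)// (max_idPr _) ?cos_pihalf//.
by rewrite -subr_ge0 opprK addr_ge0// ltW.
Qed.

Lemma cos_bump_in (x : R) : `[tau - e, tau + e]%classic x ->
  cos_bump x = cos (pi / 2 / e * (x - tau)).
Proof.
rewrite /= in_itv/= => /andP[xl xr]; rewrite /cos_bump argE.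
have h1 : - (pi / 2) <= pi / 2 * ((x - tau) / e).
  by rewrite -[leLHS]mulrN1 ler_pM2l// ler_pdivlMr// mulN1r; lra.
have h2 : pi / 2 * ((x - tau) / e) <= pi / 2.
  by rewrite ler_piMr ?(ltW pi20)// ler_pdivrMr// mul1r; lra.
by rewrite (min_idPr _)// (max_idPr _).
Qed.

Lemma cos_bump_ge0 (x : R) : 0 <= cos_bump x.
Proof.
apply: cos_ge0_pihalf; rewrite le_max lexx/= ge_max ge_min lexx/= andbT.
by rewrite -subr_ge0 opprK addr_ge0// ltW.
Qed.

Lemma cos_bump_le1 (x : R) : cos_bump x <= 1.
Proof. exact: cos_le1. Qed.

Lemma cos_bump_ge_half (x : R) : `[tau - e / 2, tau + e / 2]%classic x -> 1 / 2 <= cos_bump x.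
Proof.
move=> xh; move: (xh); rewrite /= in_itv/= => /andP[xl xr].
have xe : `[tau - e, tau + e]%classic x.
  rewrite /= in_itv/=; apply/andP; split; move: e0 xl xr; lra.
set t := pi / 2 / e * (x - tau).
(* the doubled angle stays within the half period where the cosine is nonnegative *)
have : 0 <= cos (t + t).
  have tE : t + t = pi / 2 * ((x - tau) * 2 / e) by rewrite /t; field; rewrite gt_eqF.
  apply: cos_ge0_pihalf; rewrite tE; apply/andP; split.
    by rewrite -[leLHS]mulrN1 ler_pM2l// ler_pdivlMr// mulN1r; lra.
  by rewrite ler_piMr ?(ltW pi20)// ler_pdivrMr// mul1r; lra.
have := cos_bump_ge0 x; rewrite cos_bump_in// -/t cosD.
by have := cos2Dsin2 t; rewrite !expr2; nra.
Qed.

End cosine_bump.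

Section nevanlinna_averages.
Context {R : realType}.
Local Notation leb := (@lebesgue_measure R).
Variables (f : R[i] -> R[i]) (mu : {measure set (measurableTypeR R) -> \bar R}) (tau : R).
Hypothesis f_analytic : analytic_on (@upper_half_plane R) f.
Hypothesis f_closed : maps_to_closed_half_plane f.
Hypothesis mu_f : nevanlinna_measure f mu.

Definition centered_mass (t : R) : \bar R := mu `[tau - t, tau + t]%classic.

Lemma centered_mass_fin t : centered_mass t \is a fin_num.
Proof.
rewrite ge0_fin_numE ?measure_ge0//.
by apply: (proj1 mu_f); exact: segment_compact.
Qed.

Definition horizontal_integral (e y : R) : R :=
  \int[leb]_(x in `[- e, e]) complex.Im (f ((tau + x) +i* y)).

Let u x y := complex.Im (f (x +i* y)).
Let v x y := complex.Re (f (x +i* y)).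

Let cos_bump_integral e y := \int[leb]_x (cos_bump tau e x * u x y).

Let derivative : exists d : R[i] -> R[i],
  forall z, upper_half_plane z -> strict_derivative f z (d z).
Proof. exact: analytic_strict_derivative f_analytic. Qed.

Let Im_horizontal_continuous y : 0 < y -> continuous (u ^~ y).
Proof.
have [d fd] := derivative => y0.
by apply: (is_derive_continuous (fun x => is_derive_Im_horizontal (fd (x +i* y) y0))).
Qed.

Let bump_cos_averageE e y : 0 < e -> cos_bump_integral e y = cos_average u tau e y.
Proof.
move=> e0; rewrite /cos_average Rintegral_mkcond /cos_bump_integral.
apply: eq_Rintegral => x _; rewrite patchE; case: ifPn => [|]; rewrite ?inE ?notin_setE => xab.
  by rewrite cos_bump_in.
by rewrite cos_bump_out ?mul0r.
Qed.

Let horizontal_integralE e y : 0 < e -> 0 < y ->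
  horizontal_integral e y = \int[leb]_(x in `[tau - e, tau + e]) u x y.
Proof.
move=> e0 y0; rewrite /horizontal_integral (@Rintegral_translation _ (u ^~ y))//.
  by rewrite ge0_cp// ltW.
exact: Im_horizontal_continuous.
Qed.

Lemma horizontal_integrable (e y : R) : 0 < y ->
  leb.-integrable `[- e, e] (EFin \o (fun x => complex.Im (f ((tau + x) +i* y)))).
Proof.
move=> y0; apply: continuous_integrable_segment.
have ct : continuous (fun x : R => tau + x).
  by move=> x; apply: cvgD; [exact: cvg_cst|exact: cvg_id].
by move=> x; exact: (continuous_comp (ct x) (@Im_horizontal_continuous _ y0 _)).
Qed.

Let cos_average_exp_nd e y l : 0 < e -> 0 < y -> y <= l ->
  expR (pi / 2 / e * y) * cos_average u tau e y <=
  expR (pi / 2 / e * l) * cos_average u tau e l.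
Proof.
have [d fd] := derivative => e0.
apply: (@cos_average_exp_nondecreasing _ u v
  (fun x y => complex.Re (d (x +i* y))) (fun x y => complex.Im (d (x +i* y)))) => //.
- by move=> a b b0; apply: is_derive_Im_horizontal; exact: fd.
- by move=> a b b0; apply: is_derive_Re_horizontal; exact: fd.
- by move=> a b b0; apply: is_derive_Im_vertical; exact: fd.
- by move=> a b b0; apply: is_derive_Re_vertical; exact: fd.
- move=> a b b0; apply: (continuous_derivative_coordinate _ _ fd b0); last exact: norm_Re_le.
  by move=> [? ?] [? ?].
- move=> a b b0; apply: (continuous_derivative_coordinate _ _ fd b0); last exact: norm_Im_le.
  by move=> [? ?] [? ?].
- by move=> a b b0; exact: f_closed.
Qed.

Let bump_cvg e : 0 < e ->
  cos_average u tau e y @[y --> 0^'+] --> \int[mu]_x cos_bump tau e x.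
Proof.
move=> e0.
have -> : (fun y => cos_average u tau e y) =
    (fun y => \int[leb]_x (cos_bump tau e x * complex.Im (f (x +i* y)))).
  by apply/funext => y; rewrite -bump_cos_averageE.
apply: (proj2 mu_f); first exact: cos_bump_continuous.
exists `[tau - e, tau + e]%classic; first exact: segment_compact.
by move=> x; exact: cos_bump_out.
Qed.

Let bump_mass e : 0 < e ->
  fine (centered_mass (e / 2)) / 2 <= \int[mu]_x cos_bump tau e x <= fine (centered_mass e).
Proof.
move=> e0.
have mb : measurable_fun [set: measurableTypeR R] (fun x => (cos_bump tau e x)%:E).
  by apply/measurable_EFinP; apply: continuous_measurable_fun; exact: cos_bump_continuous.
have up : (\int[mu]_x (cos_bump tau e x)%:E <= centered_mass e)%E.
  rewrite /centered_mass -[X in (_ <= mu X)%E]setIT -integral_indic//.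
  apply: ge0_le_integral => //.
  - by move=> x _; rewrite lee_fin cos_bump_ge0.
  - by apply/measurable_EFinP; exact: measurable_indic.
  - move=> x _; rewrite lee_fin indicE; case: (boolP (x \in _)); rewrite ?inE ?notin_setE => xab.
      exact: cos_bump_le1.
    by rewrite cos_bump_out.
have low : ((1 / 2)%:E * centered_mass (e / 2) <= \int[mu]_x (cos_bump tau e x)%:E)%E.
  rewrite /centered_mass -[X in mu X]setIT -integral_indic// -ge0_integralZl_EFin//; last first.
    by apply/measurable_EFinP; exact: measurable_indic.
  apply: ge0_le_integral => //.
  - by apply: measurable_funeM; apply/measurable_EFinP; exact: measurable_indic.
  - move=> x _; rewrite -EFinM lee_fin indicE; case: (boolP (x \in _)); rewrite ?inE ?notin_setE => xab.
      by rewrite mulr1 cos_bump_ge_half.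
    by rewrite mulr0 cos_bump_ge0.
have fin : (\int[mu]_x (cos_bump tau e x)%:E)%E \is a fin_num.
  rewrite ge0_fin_numE ?(le_lt_trans up)// ?ltey_eq ?centered_mass_fin//.
  by apply: integral_ge0 => x _; rewrite lee_fin cos_bump_ge0.
rewrite /Rintegral; apply/andP; split.
  rewrite -lee_fin fineK// EFinM muleC fineK ?centered_mass_fin//.
  by rewrite -[X in (X%:E * _)%E]mul1r.
by rewrite -lee_fin !fineK// centered_mass_fin.
Qed.

Let u_ge0 x y : 0 < y -> 0 <= u x y.
Proof. move=> y0; exact: f_closed. Qed.

(** Positivity of [Im f] replaces the Poisson representation: the cosine average can
    decrease with the height at most exponentially, with rate [pi / (2 e)]. *)
Lemma centered_mass_le_horizontal_integral (e y : R) : 0 < e -> 0 < y ->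
  fine (centered_mass (e / 2)) / 2 <= expR (pi / 2 / e * y) * horizontal_integral e y.
Proof.
move=> e0 y0; have /andP[h _] := bump_mass e0; apply: le_trans h _.
apply: (@le_trans _ _ (expR (pi / 2 / e * y) * cos_average u tau e y)).
  apply: (cvgr_to_le (bump_cvg e0)); near=> s.
  have s0 : 0 < s by [].
  apply: le_trans (cos_average_exp_nd e0 s0 _); last first.
    by apply: ltW; near: s; exact: nbhs_right_lt.
  have : 1 <= expR (pi / 2 / e * s).
    by rewrite -expR0 ler_expR mulr_ge0 ?(ltW s0)// !divr_ge0 ?pi_ge0// ltW.
  by move=> ?; rewrite ler_peMl// -bump_cos_averageE// Rintegral_ge0// => x _; rewrite mulr_ge0 ?cos_bump_ge0 ?u_ge0.
rewrite ler_wpM2l ?expR_ge0// horizontal_integralE//.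
apply: le_Rintegral => //.
- apply: continuous_integrable_segment => x.
  apply: cvgM; last exact: (Im_horizontal_continuous y0).
  have c0 : continuous (fun x : R => pi / 2 / e * (x - tau)).
    move=> t; apply: cvgM; first exact: cvg_cst.
    by apply: cvgB; [exact: cvg_id|exact: cvg_cst].
  exact: (continuous_comp (c0 x) (@continuous_cos _ _)).
- by apply: continuous_integrable_segment; exact: Im_horizontal_continuous.
- by move=> x _; rewrite ler_piMl ?u_ge0// cos_le1.
Unshelve. all: by end_near. Qed.

(** The cosine of doubled width is at least [1 / 2] on the segment, and its average tends to
    an integral against [mu] of a function between [0] and the indicator of the doubled
    segment. *)
Lemma horizontal_integral_le_centered_mass (e eta : R) : 0 < e -> 0 < eta ->
  exists2 l0 : R, 0 < l0 & forall l, 0 < l < l0 ->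
    horizontal_integral e l <= 2 * (fine (centered_mass (2 * e)) + eta).
Proof.
move=> e0 eta0; have e20 : 0 < 2 * e by rewrite mulr_gt0.
have /andP[_ up] := bump_mass e20.
have lt : \int[mu]_x cos_bump tau (2 * e) x < fine (centered_mass (2 * e)) + eta.
  by apply: le_lt_trans up _; rewrite ltrDl.
have /(cvgr_lt _ (bump_cvg e20)) := lt; rewrite near_withinE => -[l0 /= l00 Hl0].
exists l0 => // l /andP[lp ll0].
have := Hl0 l; rewrite /= sub0r normrN gtr0_norm// => /(_ ll0 lp) ltl.
apply: le_trans (ler_wpM2l (ler0n _ 2) (ltW ltl)).
rewrite horizontal_integralE//.
have cu := Im_horizontal_continuous lp.
have cb := @cos_bump_continuous _ tau (2 * e).
have ci : continuous (fun x => 2 * (cos_bump tau (2 * e) x * u x l)).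
  move=> x; apply: cvgM; first exact: cvg_cst.
  by apply: cvgM; [exact: cb|exact: cu].
have -> : cos_average u tau (2 * e) l =
    \int[leb]_(x in `[tau - 2 * e, tau + 2 * e]) (cos_bump tau (2 * e) x * u x l).
  by apply: eq_Rintegral => x; rewrite inE => xab; rewrite cos_bump_in.
rewrite -RintegralZl//; last first.
  apply: continuous_integrable_segment => x.
  by apply: cvgM; [exact: cb|exact: cu].
apply: (@le_trans _ _ (\int[leb]_(x in `[tau - e, tau + e]) (2 * (cos_bump tau (2 * e) x * u x l)))).
  apply: le_Rintegral => //; try exact: continuous_integrable_segment.
  move=> x xe; rewrite mulrA ler_peMl ?u_ge0// mulrC -ler_pdivrMr//.
  by apply: cos_bump_ge_half => //; rewrite mulrAC divff ?mul1r.
apply: Rintegral_le_subset => //.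
- exact: continuous_integrable_segment.
- by move=> x _; rewrite !mulr_ge0 ?cos_bump_ge0 ?u_ge0.
- by apply: subset_itv; rewrite bnd_simp lerD2l ?lerN2 ler_peMl ?ler1n ?ltW.
Qed.

End nevanlinna_averages.

(** * The Stieltjes measure of a monotone function *)

Lemma measurable_fun_inve_ge0 d (T : measurableType d) (R : realType) (w : T -> R) :
  measurable_fun setT w -> (forall x, 0 <= w x) ->
  measurable_fun setT (fun x => ((w x)%:E^-1)%E).
Proof.
move=> mw w0.
rewrite (_ : (fun x => _) = (fun x => if w x == 0 then +oo%E else (w x `^ (-1))%:E)); last first.
  by apply/funext => x; rewrite inver powR_inv1.
apply: measurable_fun_ifT => //; first by apply: measurable_fun_eqr => //; exact: measurable_cst.
apply/measurable_EFinP.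
exact: (measurableT_comp (measurable_powR _) mw).
Qed.

Section one_sided_limits.
Context {R : realType}.
Variables (gamma : R -> R) (gamma_nd : nondecreasing_on_nneg gamma).
Local Notation L := (left_val gamma).
Local Notation g := (right_val gamma).
Local Notation nu := (dmeasure gamma_nd).

Lemma is_cvg_left_val t : cvg (ext0 gamma x @[x --> t^'-]).
Proof.
apply: (@nondecreasing_at_left_is_cvgr R (ext0 gamma) t).
  by near=> b => x y _ _; exact: ext0_homo.
near=> b; exists (ext0 gamma t) => _ [x /= xt <-].
by apply: ext0_homo => //; move: xt; rewrite in_itv/= => /andP[_ /ltW].
Unshelve. all: by end_near. Qed.

Lemma left_val_le t M : (forall s, s < t -> ext0 gamma s <= M) -> L t <= M.
Proof. by move=> H; apply: (limr_le (@is_cvg_left_val t)); near=> s; apply: H.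
Unshelve. all: by end_near. Qed.

Lemma left_val_le_ext0 t : L t <= ext0 gamma t.
Proof. by apply: left_val_le => s /ltW; exact: ext0_homo. Qed.

Lemma ext0_le_left_val s t : s < t -> ext0 gamma s <= L t.
Proof.
move=> st; apply: (limr_ge (@is_cvg_left_val t)); near=> x.
by apply: ext0_homo => //; apply: ltW; near: x; exact: nbhs_left_gt.
Unshelve. all: by end_near. Qed.

Lemma left_val_le_right_val t : L t <= g t.
Proof. exact: le_trans (left_val_le_ext0 t) (ext0_le_right_val gamma_nd t). Qed.

Lemma right_val_le_left_val s t : s < t -> g s <= L t.
Proof.
move=> st; have m1 : s < (s + t) / 2 by rewrite midf_lt.
have m2 : (s + t) / 2 < t by rewrite midf_lt.
exact: le_trans (right_val_le_ext0 gamma_nd m1) (ext0_le_left_val m2).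
Qed.

Lemma left_val_nondecreasing : {homo L : s t / s <= t}.
Proof.
move=> s t; rewrite le_eqVlt => /predU1P[->//|st].
exact: le_trans (left_val_le_right_val s) (right_val_le_left_val st).
Qed.

Lemma right_val_approx t e : 0 < e -> exists2 s, t < s & g s <= g t + e.
Proof.
move=> e0; have /cvgrPdist_le/(_ _ e0) := @right_val_right_continuous _ _ gamma_nd t.
rewrite near_withinE => -[r /= r0 H]; exists (t + r / 2).
  by rewrite ltrDl divr_gt0.
have := H (t + r / 2); rewrite /= opprD addNKr normrN gtr0_norm ?divr_gt0//.
rewrite ltr_pdivrMr// ltr_pMr// ltr1n ltrDl divr_gt0// => /(_ isT isT).
rewrite distrC ger0_norm ?subr_ge0 ?lerBlDl//.
by apply: right_val_nondecreasing => //; rewrite lerDl divr_ge0// ltW.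
Qed.

Lemma dmeasure_itvoc a b : a <= b -> nu `]a, b]%classic = (g b - g a)%:E.
Proof.
move=> ab; rewrite /dmeasure /= /lebesgue_stieltjes_measure/= /measure_extension/=.
rewrite measurable_mu_extE/=; last exact: is_ocitv.
by rewrite wlength_itv_bnd.
Qed.

Lemma right_val_cvg_left_val t : g (t - n.+1%:R^-1) @[n --> \oo] --> L t.
Proof.
have c : ext0 gamma (t - n.+1%:R^-1) @[n --> \oo] --> L t.
  move/cvg_at_leftP : (@is_cvg_left_val t); apply; split; first by move=> n; rewrite gtrDl oppr_lt0 invr_gt0.
  by rewrite -[X in _ --> X]subr0; apply: cvgB; [exact: cvg_cst|exact: cvg_harmonic].
apply: (squeeze_cvgr _ c (cvg_cst _)); near=> n.
rewrite ext0_le_right_val//= right_val_le_left_val//.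
by rewrite gtrDl oppr_lt0 invr_gt0.
Unshelve. all: by end_near. Qed.

Lemma dmeasure_set1 t : nu [set t] = (g t - L t)%:E.
Proof.
have seqE : nu \o (fun n => `]t - n.+1%:R^-1, t]%classic) =
    (fun n => (g t - g (t - n.+1%:R^-1))%:E).
  by apply/funext => n /=; rewrite dmeasure_itvoc// gerBl invr_ge0.
have c1 : nu \o (fun n => `]t - n.+1%:R^-1, t]%classic) @ \oo --> nu [set t].
  rewrite set1_bigcap_oc; apply: nonincreasing_cvg_mu => //.
  - by rewrite dmeasure_itvoc ?ltry// gerBl invr_ge0.
  - exact: bigcap_measurable.
  - move=> m n mn; apply/subsetPset => x /=; rewrite !in_itv/= => /andP[tx ->].
    by rewrite andbT; apply: le_lt_trans tx; rewrite lerB// lef_pV2 ?ler_nat ?posrE.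
have c2 : nu \o (fun n => `]t - n.+1%:R^-1, t]%classic) @ \oo --> (g t - L t)%:E.
  rewrite seqE; apply: cvg_EFin; first exact: nearW.
  by apply: cvgB; [exact: cvg_cst|exact: right_val_cvg_left_val].
exact: cvg_unique c1 c2.
Qed.

Lemma dmeasure_itvoo a b : a < b -> nu `]a, b[%classic = (L b - g a)%:E.
Proof.
move=> ab; have := dmeasure_itvoc (ltW ab).
rewrite -(setUitv1 true)// measureU//; last first.
  by apply/seteqP; split => // x [/= + xb]; rewrite in_itv/= xb ltxx andbF.
rewrite [X in (_ + X)%E]dmeasure_set1.
have key (y : \bar R) : (y + (g b - L b)%:E = (g b - g a)%:E)%E -> y = (L b - g a)%:E.
  by case: y => [r| |]//= [rE]; congr EFin; rewrite -[r](addrK (g b - L b)) rE; ring.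
exact: key.
Qed.

End one_sided_limits.

(** * Increments of the reciprocal of a monotone function *)

Lemma inv_prod_bounds (R : realFieldType) (c x y d : R) :
  0 < c -> c <= x -> x <= y -> y <= d -> d <= 2 * c ->
  (2 * (c * d))^-1 <= (x * y)^-1 <= 2 / (c * d).
Proof.
move=> c0 cx xy yd d2.
have x0 := lt_le_trans c0 cx; have y0 := lt_le_trans x0 xy; have d0 := lt_le_trans y0 yd.
have cc : c * c <= x * y by apply: ler_pM; rewrite ?(ltW c0)// (le_trans cx).
have dd : x * y <= d * d by apply: ler_pM; rewrite ?(ltW x0) ?(ltW y0)// (le_trans xy).
apply/andP; split.
  by rewrite lef_pV2 ?posrE ?mulr_gt0//; apply: le_trans dd _; rewrite mulrA ler_pM2r.
have -> : 2 / (c * d) = (c * d / 2)^-1 by rewrite invf_div.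
rewrite lef_pV2 ?posrE ?divr_gt0 ?mulr_gt0//; apply: le_trans cc.
by rewrite -mulrA ler_pM2l// ler_pdivrMr// mulrC.
Qed.

Lemma inv_sub_prodE (R : realFieldType) (c d : R) : 0 < c -> 0 < d ->
  c^-1 - d^-1 = (d - c) / (c * d).
Proof. by move=> c0 d0; field; rewrite !gt_eqF. Qed.

Section reciprocal_increments.
Context {R : realType}.
Variables (gamma : R -> R) (gamma_nd : nondecreasing_on_nneg gamma).
Hypothesis gamma_ge0 : forall t : R, 0 <= t -> 0 <= gamma t.
Hypothesis gamma_gt0 : forall t : R, 0 < t -> 0 < gamma t.
Local Notation L := (left_val gamma).
Local Notation g := (right_val gamma).
Local Notation nu := (dmeasure gamma_nd).

Definition inverse_density (t : R) : \bar R := ((L t * g t)%:E^-1)%E.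
Local Notation k := inverse_density.

Lemma ext0_ge0 t : 0 <= ext0 gamma t.
Proof. by apply: gamma_ge0; rewrite le_max lexx orbT. Qed.

Lemma ext0E t : 0 <= t -> ext0 gamma t = gamma t.
Proof. by move=> t0; rewrite /ext0 (max_idPl _). Qed.

Lemma left_val_ge0 t : 0 <= L t.
Proof. apply: le_trans (ext0_le_left_val gamma_nd (_ : t - 1 < t)); first exact: ext0_ge0.
by rewrite gtrBl. Qed.

Lemma right_val_ge0 t : 0 <= g t.
Proof. exact: le_trans (left_val_ge0 t) (left_val_le_right_val gamma_nd t). Qed.

Lemma gamma_le_left_val s t : 0 <= s -> s < t -> gamma s <= L t.
Proof. by move=> s0 st; rewrite -(ext0E s0); exact: ext0_le_left_val. Qed.

Lemma left_val_gt0 t : 0 < t -> 0 < L t.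
Proof.
move=> t0; apply: (@lt_le_trans _ _ (gamma (t / 2))).
  by rewrite gamma_gt0// divr_gt0.
by apply: gamma_le_left_val; rewrite ?divr_ge0 ?ltW// ltr_pdivrMr// ltr_pMr// ltr1n.
Qed.

Lemma inverse_density_ge0 t : (0 <= k t)%E.
Proof. by rewrite /k inve_ge0 lee_fin mulr_ge0 ?left_val_ge0 ?right_val_ge0. Qed.

Lemma measurable_inverse_density : measurable_fun [set: R] k.
Proof.
apply: measurable_fun_inve_ge0; last by move=> t; rewrite mulr_ge0 ?left_val_ge0 ?right_val_ge0.
by apply: measurable_funM; apply: nondecreasing_measurable => //;
  [exact: left_val_nondecreasing|exact: right_val_nondecreasing].
Qed.

Lemma inverse_densityE t : 0 < L t -> k t = ((L t * g t)^-1)%:E.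
Proof.
move=> L0; have g0 := lt_le_trans L0 (left_val_le_right_val gamma_nd t).
by rewrite /k inver gt_eqF// mulr_gt0.
Qed.

Let integral_atom a : 0 < L a ->
  (\int[nu]_(t in [set a]) k t = ((L a)^-1 - (g a)^-1)%:E)%E.
Proof.
move=> L0; have g0 := lt_le_trans L0 (left_val_le_right_val gamma_nd a).
rewrite (eq_integral (cst (k a))); last by move=> t; rewrite inE => ->.
rewrite integral_cst// inverse_densityE// [X in (_ * X)%E]dmeasure_set1 -EFinM; congr EFin.
by rewrite inv_sub_prodE// mulrC.
Qed.

(** The factor two leaves room for intervals on which [gamma] varies by a factor of at most
    two; equality would require arbitrarily fine partitions, and a constant factor is
    harmless for integrability. *)
Definition comparable_integral (A : set R) (D : R) :=
  exists I : R, [/\ (\int[nu]_(t in A) k t = I%:E)%E, D <= 2 * I & I <= 2 * D].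

Let comparable_setU (A B : set R) (D E : R) : measurable A -> measurable B -> [disjoint A & B] ->
  comparable_integral A D -> comparable_integral B E -> comparable_integral (A `|` B) (D + E).
Proof.
move=> mA mB AB [I [I1 I2 I3]] [J [J1 J2 J3]]; exists (I + J); split; last 2 first.
- by rewrite mulrDr lerD.
- by rewrite mulrDr lerD.
rewrite ge0_integral_setU//; last 2 first.
- by apply: measurable_funTS; exact: measurable_inverse_density.
- by move=> x _; exact: inverse_density_ge0.
by rewrite [X in (X + _)%E]I1 [X in (_ + X)%E]J1.
Qed.

(** As [gamma] at most doubles inside the interval, the density is within a factor of two
    of [1 / (gamma (a+) gamma (p-))]. *)
Let comparable_itvoo a p : a < p -> 0 < g a -> L p <= 2 * g a ->
  comparable_integral `]a, p[%classic ((g a)^-1 - (L p)^-1).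
Proof.
move=> ap ga0 Lp2.
have gL := right_val_le_left_val gamma_nd ap.
have Lp0 : 0 < L p := lt_le_trans ga0 gL.
have X0 : 0 < g a * L p by rewrite mulr_gt0.
have DE := inv_sub_prodE ga0 Lp0.
have bound s : `]a, p[%classic s -> (2 * (g a * L p))^-1 <= (L s * g s)^-1 <= 2 / (g a * L p).
  rewrite /= in_itv/= => /andP[as_ sp].
  have Ls1 := right_val_le_left_val gamma_nd as_.
  have Ls2 := left_val_le_right_val gamma_nd s.
  have Ls3 := right_val_le_left_val gamma_nd sp.
  exact: inv_prod_bounds ga0 Ls1 Ls2 Ls3 Lp2.
have kE s : `]a, p[%classic s -> k s = ((L s * g s)^-1)%:E.
  rewrite /= in_itv/= => /andP[as_ _]; apply: inverse_densityE.
  exact: lt_le_trans ga0 (right_val_le_left_val gamma_nd as_).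
have nuE := dmeasure_itvoo gamma_nd ap.
have mk : measurable_fun `]a, p[%classic k.
  by apply: measurable_funTS; exact: measurable_inverse_density.
have up : (\int[nu]_(t in `]a, p[) k t <= (2 / (g a * L p) * (L p - g a))%:E)%E.
  rewrite EFinM -nuE -integral_cst//; apply: ge0_le_integral => //.
  - by move=> s _; exact: inverse_density_ge0.
  - by move=> s /[dup] sap /bound/andP[_ ?]; rewrite kE// lee_fin.
have low : (((2 * (g a * L p))^-1 * (L p - g a))%:E <= \int[nu]_(t in `]a, p[) k t)%E.
  rewrite EFinM -nuE -integral_cst//; apply: ge0_le_integral => //.
  - by move=> s _; rewrite /= lee_fin invr_ge0 mulr_ge0 ?(ltW X0).
  - by move=> s /[dup] sap /bound/andP[? _]; rewrite kE// lee_fin.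
have fin : (\int[nu]_(t in `]a, p[) k t)%E \is a fin_num.
  rewrite ge0_fin_numE ?(le_lt_trans up) ?ltry//.
  by apply: integral_ge0 => s _; exact: inverse_density_ge0.
exists (fine (\int[nu]_(t in `]a, p[) k t)%E); split; first by rewrite fineK.
- have : (2 * (g a * L p))^-1 * (L p - g a) <= fine (\int[nu]_(t in `]a, p[) k t)%E.
    by rewrite -lee_fin fineK.
  by rewrite DE invfM -mulrA ler_pdivrMl// [X in X <= _]mulrC.
- have : fine (\int[nu]_(t in `]a, p[) k t)%E <= 2 / (g a * L p) * (L p - g a).
    by rewrite -lee_fin fineK.
  by rewrite DE -mulrA [X in 2 * X]mulrC.
Qed.

Let comparable_atom a : 0 < L a -> comparable_integral [set a] ((L a)^-1 - (g a)^-1).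
Proof.
move=> L0; exists ((L a)^-1 - (g a)^-1).
have D0 : 0 <= (L a)^-1 - (g a)^-1.
  rewrite subr_ge0 lef_pV2 ?posrE ?left_val_le_right_val//.
  exact: lt_le_trans L0 (left_val_le_right_val gamma_nd a).
have le2 (x : R) : 0 <= x -> x <= 2 * x by move=> x0; rewrite ler_peMl// ler1n.
by split; [exact: integral_atom|exact: le2|exact: le2].
Qed.

(** The first point where [gamma] has doubled splits off an interval of the previous
    kind, a jump, and an interval on which one doubling less remains. *)
Let comparable_doubling n a b : a < b -> 0 < L a -> L b <= 2 ^+ n.+1 * g a ->
  comparable_integral `[a, b[%classic ((L a)^-1 - (L b)^-1).
Proof.
have near c d : c < d -> 0 < L c -> L d <= 2 * g c ->
    comparable_integral ([set c] `|` `]c, d[%classic) ((L c)^-1 - (L d)^-1).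
  move=> cd Lc0 Ld2.
  have gc0 := lt_le_trans Lc0 (left_val_le_right_val gamma_nd c).
  have -> : (L c)^-1 - (L d)^-1 = ((L c)^-1 - (g c)^-1) + ((g c)^-1 - (L d)^-1).
    by rewrite addrA subrK.
  apply: comparable_setU => //; [|exact: comparable_atom|exact: comparable_itvoo].
  by apply/disj_setPS => x [/= ->]; rewrite in_itv/= ltxx.
elim: n a => [|n IH] a ab La0 Lb2.
  by rewrite -(setU1itv false)//; apply: near => //; rewrite -(expr1 2).
have [Lb2'|Lb2'] := leP (L b) (2 * g a).
  by rewrite -(setU1itv false)//; exact: near.
have ga0 := lt_le_trans La0 (left_val_le_right_val gamma_nd a).
pose S := [set s | a < s <= b /\ L s <= 2 * g a].
have [s0 as0 gs0] := right_val_approx gamma_nd a ga0.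
have S_right s : a < s -> g s <= 2 * g a -> s < b /\ S s.
  move=> as_ gs; have sb : s < b.
    rewrite ltNge; apply/negP => bs; move: Lb2'; apply/negP; rewrite -leNgt.
    apply: le_trans gs; apply: le_trans (left_val_le_right_val gamma_nd _) _.
    exact: right_val_nondecreasing.
  split => //; split; first by rewrite as_ ltW.
  exact: le_trans (left_val_le_right_val gamma_nd s) gs.
have Ss0 : S s0 by apply: (S_right _ as0 _).2; rewrite mulr2n mulrDl mul1r.
have supS : has_sup S by split; [exists s0|exists b => s [/andP[]]].
pose p := sup S.
have ap : a < p by apply: lt_le_trans as0 _; apply: sup_upper_bound.
have pb : p <= b by apply: sup_le_ub; [exists s0|move=> s [/andP[]]].
have Lp2 : L p <= 2 * g a.
  apply: (left_val_le gamma_nd) => s sp.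
  have [t [_ Lt] st] := sup_gt supS.1 sp.
  exact: le_trans (ext0_le_left_val gamma_nd st) Lt.
have {}pb : p < b.
  by rewrite lt_neqAle pb andbT; apply: contraTneq Lp2 => ->; rewrite -ltNge.
have gp2 : 2 * g a <= g p.
  rewrite leNgt; apply/negP => gp2.
  have d0 : 0 < 2 * g a - g p by rewrite subr_gt0.
  have [s ps gs] := right_val_approx gamma_nd p d0.
  rewrite subrKC in gs; have [_ Ss] := S_right s (lt_trans ap ps) gs.
  by move: ps; apply/negP; rewrite -leNgt; apply: sup_upper_bound.
have Lp0 : 0 < L p := lt_le_trans ga0 (right_val_le_left_val gamma_nd ap).
have -> : (L a)^-1 - (L b)^-1 = ((L a)^-1 - (L p)^-1) + ((L p)^-1 - (L b)^-1).
  by rewrite addrA subrK.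
have -> : `[a, b[%classic = ([set a] `|` `]a, p[%classic) `|` `[p, b[%classic.
  rewrite (setU1itv false)//; apply: itv_bndbnd_setU; rewrite bnd_simp ltW//.
have Lb2n : L b <= 2 ^+ n.+1 * g p.
  by apply: le_trans Lb2 _; rewrite exprSr -mulrA ler_pM2l ?exprn_gt0.
apply: (comparable_setU _ _ _ (near _ _ ap La0 Lp2) (IH _ pb Lp0 Lb2n)) => //.
  by rewrite setU1itv// bnd_simp.
rewrite setU1itv ?bnd_simp//; apply/disj_setPS => x [/=]; rewrite !in_itv/= => /andP[_ xp] /andP[px _].
by move: px; rewrite leNgt xp.
Qed.

(** Up to constants, the density [1 / (gamma (t-) gamma (t+))] is the derivative of
    [- 1 / gamma]. *)
Lemma comparable_itvco a b : a < b -> 0 < L a ->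
  comparable_integral `[a, b[%classic ((L a)^-1 - (L b)^-1).
Proof.
move=> ab La0.
have ga0 := lt_le_trans La0 (left_val_le_right_val gamma_nd a).
apply: (@comparable_doubling (Num.bound (L b / g a))) => //.
rewrite -ler_pdivrMr//; apply: ltW; apply: upper_nthrootP; exact: leqW.
Qed.

Lemma integral_inverse_density_le a b : 0 <= a -> a < b ->
  (\int[nu]_(t in `[a, b[) k t <= 2%:E * (L a)%:E^-1)%E.
Proof.
move=> a0 ab; have [La0|La0] := eqVneq (L a) 0.
  by rewrite inver La0 eqxx gt0_muley ?leey// lte_fin.
have {}La0 : 0 < L a by rewrite lt_def La0 left_val_ge0.
have [I [-> _ I2]] := comparable_itvco ab La0.
rewrite inver gt_eqF// -EFinM lee_fin; apply: le_trans I2 _.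
by rewrite ler_wpM2l// gerBl invr_ge0 left_val_ge0.
Qed.

(** When [gamma] vanishes at [0] the left side is infinite for [a = 0], and so is the
    integral. *)
Lemma inve_left_val_le_integral a b : 0 <= a -> a < b ->
  ((L a)%:E^-1 <= (L b)%:E^-1 + 2%:E * \int[nu]_(t in `[a, b[) k t)%E.
Proof.
move=> a0 ab; have b0 := le_lt_trans a0 ab; have Lb0 := left_val_gt0 b0.
have [La0|La0] := eqVneq (L a) 0; last first.
  have {}La0 : 0 < L a by rewrite lt_def La0 left_val_ge0.
  have [I [-> I1 _]] := comparable_itvco ab La0.
  by rewrite !inver !gt_eqF// -EFinM -EFinD lee_fin -lerBlDl.
suff -> : (\int[nu]_(t in `[a, b[) k t = +oo)%E.
  by rewrite gt0_muley ?lte_fin// (inver (L b)) (gt_eqF Lb0) addey// leey.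
have sub A : measurable A -> A `<=` `[a, b[%classic ->
    (\int[nu]_(t in A) k t <= \int[nu]_(t in `[a, b[) k t)%E.
  move=> mA AB; apply: ge0_subset_integral => //.
    by apply: measurable_funTS; exact: measurable_inverse_density.
  by move=> t _; exact: inverse_density_ge0.
(* either the density is infinite at an atom of the measure, or the integrals over
   `[p, b[ grow like 1 / L p as p decreases to a *)
have [ga0|ga0] := eqVneq (g a) 0; last first.
  have {}ga0 : 0 < g a by rewrite lt_def ga0 right_val_ge0.
  apply/eqP; rewrite -leye_eq.
  apply: le_trans (sub [set a] _ _) => //; last by move=> t ->; rewrite /= in_itv/= lexx.
  rewrite (eq_integral (cst (k a))); last by move=> t; rewrite inE => ->.
  rewrite integral_cst// [X in (_ * X)%E]dmeasure_set1 La0 subr0 /k La0 mul0r inve0.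
  by rewrite gt0_mulye ?lte_fin.
apply/eqyP => A A0.
pose e := (L b)^-1 + 2 * A; have e0 : 0 < e by rewrite addr_gt0 ?invr_gt0// mulr_gt0.
have ei : 0 < e^-1 by rewrite invr_gt0.
have [s as_ gs] := right_val_approx gamma_nd a ei.
pose p := Num.min s ((a + b) / 2).
have ap : a < p by rewrite lt_min as_ midf_lt.
have pb : p < b by rewrite gt_min midf_lt ?orbT.
have Lp0 := left_val_gt0 (le_lt_trans a0 ap).
have Lpe : L p <= e^-1.
  apply: le_trans (left_val_le_right_val gamma_nd _) _.
  apply: le_trans (right_val_nondecreasing gamma_nd (_ : p <= s)) _.
    by rewrite ge_min lexx.
  by rewrite ga0 add0r in gs.
apply: le_trans (sub `[p, b[%classic _ _) => //; last first.
  by apply: subset_itv; rewrite bnd_simp// ltW.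
have [I [-> I1 _]] := comparable_itvco pb Lp0.
rewrite lee_fin; have : e <= (L p)^-1 by rewrite -[e]invrK lef_pV2 ?posrE.
by move: I1; rewrite /e; move: (L b)^-1 (L p)^-1 => x y; lra.
Qed.

End reciprocal_increments.

(** * Tonelli's theorem and the mass bound of a fortunate function *)

(** Sigma-finiteness is a hypothesis and not part of the type of the measures, because [mu]
    is only known to be finite on compact sets. *)
Lemma tonelli_of_sigma_finite d1 d2 (T1 : measurableType d1) (T2 : measurableType d2)
    (R : realType) (m1 : {measure set T1 -> \bar R}) (m2 : {measure set T2 -> \bar R})
    (f : T1 * T2 -> \bar R) :
  sigma_finite setT m1 -> sigma_finite setT m2 ->
  measurable_fun setT f -> (forall z, 0 <= f z)%E ->
  (\int[m1]_x \int[m2]_y f (x, y) = \int[m2]_y \int[m1]_x f (x, y))%E.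
Proof.
move=> s1 s2 mf f0.
pose F1 := isSFinite.Build _ _ _ _ (sfinite_measure_sigma_finite s1).
pose F2 := isSFinite.Build _ _ _ _ (sfinite_measure_sigma_finite s2).
pose S1 := isSigmaFinite.Build _ _ _ _ s1.
pose S2 := isSigmaFinite.Build _ _ _ _ s2.
pose n1 := HB.pack_for (SigmaFiniteMeasure.type T1 R) (Measure.sort m1) F1 S1.
pose n2 := HB.pack_for (SigmaFiniteMeasure.type T2 R) (Measure.sort m2) F2 S2.
exact: (@fubini_tonelli _ _ _ _ _ n1 n2 f mf f0).
Qed.

Lemma measurable_partial_integral d1 d2 (T1 : measurableType d1) (T2 : measurableType d2)
    (R : realType) (m2 : {measure set T2 -> \bar R}) (f : T1 * T2 -> \bar R) :
  sigma_finite setT m2 -> measurable_fun setT f -> (forall z, 0 <= f z)%E ->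
  measurable_fun setT (fun x => \int[m2]_y f (x, y))%E.
Proof.
move=> s2 mf f0.
pose F2 := isSFinite.Build _ _ _ _ (sfinite_measure_sigma_finite s2).
pose S2 := isSigmaFinite.Build _ _ _ _ s2.
pose n2 := HB.pack_for (SigmaFiniteMeasure.type T2 R) (Measure.sort m2) F2 S2.
exact: (@measurable_fun_fubini_tonelli_F _ _ _ _ _ n2 f mf f0).
Qed.

Section layer_cake.
Context {R : realType}.
Variables (mu nu : {measure set (measurableTypeR R) -> \bar R}) (k : R -> \bar R) (tau c eta : R).
Hypothesis mu_fin : forall t : R, (centered_mass mu tau t < +oo)%E.
Hypothesis nu_sigma_finite : sigma_finite setT nu.
Hypothesis mk : measurable_fun [set: measurableTypeR R] k.
Hypothesis k0 : forall t : R, (0 <= k t)%E.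
Hypothesis c0 : 0 < c.

Lemma sigma_finite_of_segments : sigma_finite setT mu.
Proof.
exists (fun n : nat => `[tau - n%:R, tau + n%:R]%classic).
  apply/esym; rewrite -subTset => x _; exists (Num.bound `|x - tau|) => //=.
  have : `|x - tau| < (Num.bound `|x - tau|)%:R by rewrite archi_boundP.
  rewrite in_itv/= ltr_norml => /andP[h1 h2]; apply/andP; split; lra.
by move=> n; split => //; exact: mu_fin.
Qed.

Let G (z : measurableTypeR R * measurableTypeR R) : \bar R :=
  if (c * `|z.1 - tau| <= z.2) && (z.2 < eta) then k z.2 else 0%E.

Let mG : measurable_fun setT G.
Proof.
apply: measurable_fun_ifT => //.
  apply: measurable_and.
    apply: measurable_fun_ler => //.
    apply: measurable_funM => //; apply: measurableT_comp => //.
    by apply: measurable_funB.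
  by apply: measurable_fun_ltr.
exact: measurableT_comp.
Qed.

Let G_ge0 z : (0 <= G z)%E. Proof. by rewrite /G; case: ifP. Qed.

Let tailE (x : measurableTypeR R) :
  (\int[nu]_(s in `[(c * `|x - tau|)%R, eta[%classic) k s = \int[nu]_s G (x, s))%E.
Proof.
rewrite integral_mkcond; apply: eq_integral => s _.
rewrite patchE /G /=; congr (if _ then _ else _).
by apply/idP/idP; rewrite inE/= in_itv/=.
Qed.

Lemma measurable_tail_integral : measurable_fun [set: measurableTypeR R]
  (fun x => \int[nu]_(s in `[(c * `|x - tau|)%R, eta[%classic) k s)%E.
Proof.
rewrite (funext tailE); exact: (measurable_partial_integral nu_sigma_finite mG G_ge0).
Qed.

(** Both sides integrate [k s] over the region [c |x - tau| <= s < eta]. *)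
Lemma layer_cake :
  (\int[mu]_x \int[nu]_(s in `[(c * `|x - tau|)%R, eta[%classic) k s =
   \int[nu]_(s in `[0%R, eta[%classic) (k s * centered_mass mu tau (s / c)))%E.
Proof.
under eq_integral do rewrite tailE.
rewrite (tonelli_of_sigma_finite sigma_finite_of_segments nu_sigma_finite mG G_ge0).
rewrite [RHS]integral_mkcond; apply: eq_integral => s _; rewrite patchE.
case: ifPn => [|]; rewrite ?inE ?notin_setE /= in_itv/= => sI; last first.
  rewrite integral0_eq// => x _; rewrite /G/=; case: ifP => // /andP[h1 h2].
  case: sI; rewrite h2 andbT; apply: le_trans h1; rewrite mulr_ge0// ltW//.
have /andP[s0 se] := sI.
rewrite -integral_cst// [RHS]integral_mkcond; apply: eq_integral => x _.
rewrite patchE /G /= se andbT; congr (if _ then _ else _).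
rewrite mulrC -ler_pdivlMr// ler_norml.
apply/idP/idP; rewrite inE/= in_itv/= => /andP[h1 h2]; apply/andP; split; lra.
Qed.

End layer_cake.

Section fortunate_averages.
Context {R : realType}.
Variables (f : R[i] -> R[i]) (mu : {measure set (measurableTypeR R) -> \bar R}) (tau : R).
Hypothesis f_analytic : analytic_on (@upper_half_plane R) f.
Hypothesis f_closed : maps_to_closed_half_plane f.
Hypothesis mu_f : nevanlinna_measure f mu.
Local Notation mass := (centered_mass mu tau).

Lemma AfkE (k lambda : R -> R) (e : R) : 0 < lambda e ->
  Afk f k lambda tau e = horizontal_integral f tau e (lambda e) / (2 * e * k (lambda e)).
Proof.
move=> l0; rewrite /Afk /fk /= RintegralZr//; last exact: horizontal_integrable.
by rewrite mulrCA -invfM.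
Qed.

Lemma limf_esup_lt_bounded (h : R -> R) :
  (limf_esup (fun e => (h e)%:E) 0^'+ < +oo)%E ->
  exists A, \forall e \near 0^'+, h e <= A.
Proof.
rewrite limf_esupE => /ereal_inf_lt[_ [V V0 <-] supV].
have ub e : V e -> ((h e)%:E <= ereal_sup [set (h e)%:E | e in V])%E.
  by move=> Ve; apply: ereal_sup_ubound; exists e.
move: supV ub; case: ereal_sup => [A _ ub| |_ ub]; first by exists A; apply: filterS V0 => e /ub.
- by rewrite ltxx.
- by exists 0; apply: filterS V0 => e /ub.
Qed.

(** The exponential loss between the real line and height [lambda e] has exponent
    [(pi / 2) (lambda e / e)], which stays bounded as [lambda e = O(e)]. *)
Lemma fortunate_mass_bound (Phi : R -> R) : pos_fun Phi -> fortunate f Phi tau ->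
  exists C M eta : R, [/\ 0 < C, 0 < M, 0 < eta &
    forall e, 0 < e < eta -> fine (mass (e / 2)) <= M * (e * Phi (C * e))].
Proof.
move=> Phi0 [C [k [lambda [[C0 k0 l0] [Phik [K [d [K0 d0 lK]]] _ supA]]]]].
have [A /= nearA] := limf_esup_lt_bounded supA.
have [d' /= d'0 HA] : exists2 d', 0 < d' & forall e, 0 < e < d' -> Afk f k lambda tau e <= A.
  move: nearA; rewrite near_withinE => -[d' /= d'0 H]; exists d' => // e /andP[e0 ed].
  by apply: H => //=; rewrite sub0r normrN gtr0_norm.
pose E := expR (pi / 2 * K).
exists C, (4 * E * (`|A| + 1)), (Num.min d d'); split => //.
- by rewrite !mulr_gt0// ?expR_gt0// ltr_wpDl.
- by rewrite lt_min d0.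
move=> e /andP[e0]; rewrite lt_min => /andP[ed ed'].
have le0 : 0 < lambda e by exact: l0.
have PC : 0 < Phi (C * e) by apply: Phi0; rewrite mulr_gt0.
have hA : horizontal_integral f tau e (lambda e) <= 2 * e * Phi (C * e) * (`|A| + 1).
  have := HA e; rewrite e0 ed' => /(_ isT); rewrite AfkE// -Phik// => h.
  have P0 : 0 < 2 * e * Phi (C * e) by rewrite !mulr_gt0.
  rewrite -ler_pdivrMl// mulrC; apply: le_trans h _.
  by apply: le_trans (ler_norm _) _; rewrite lerDl.
have lE : expR (pi / 2 / e * lambda e) <= E.
  rewrite ler_expR -mulrA ler_pM2l ?divr_gt0 ?pi_gt0// mulrC ler_pdivrMr//.
  by apply: lK => //; rewrite gtr0_norm.
have := centered_mass_le_horizontal_integral tau f_analytic f_closed mu_f e0 le0.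
rewrite ler_pdivrMr// => /le_trans; apply.
have B0 : 0 <= 2 * e * Phi (C * e) * (`|A| + 1).
  by rewrite !mulr_ge0// ?addr_ge0// ltW.
apply: (@le_trans _ _ (E * (2 * e * Phi (C * e) * (`|A| + 1)) * 2)).
  rewrite ler_wpM2r//; apply: le_trans (ler_wpM2l (expR_ge0 _) hA) _.
  by rewrite ler_wpM2r.
by rewrite le_eqVlt; apply/orP; left; apply/eqP; ring.
Qed.

End fortunate_averages.

(** * From a fortunate function to regularity *)

Section centered_mass_facts.
Context {R : realType}.
Variables (mu : {measure set (measurableTypeR R) -> \bar R}) (tau : R).
Hypothesis mu_fin : forall t : R, centered_mass mu tau t \is a fin_num.
Local Notation mass := (centered_mass mu tau).

Lemma centered_mass_le s t : s <= t -> (mass s <= mass t)%E.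
Proof.
move=> st; apply: le_measure; rewrite ?inE//.
by apply: subset_itv; rewrite bnd_simp ?lerD2l ?lerN2.
Qed.

Lemma fine_centered_mass_le : {homo (fun t => fine (mass t)) : s t / s <= t}.
Proof. by move=> s t st; rewrite -lee_fin !fineK//; exact: centered_mass_le. Qed.

Lemma fine_centered_mass_ge0 t : 0 <= fine (mass t).
Proof. by rewrite fine_ge0// measure_ge0. Qed.

Lemma measurable_fine_centered_mass : measurable_fun [set: R] (fun t => fine (mass t)).
Proof. by apply: nondecreasing_measurable => //; exact: fine_centered_mass_le. Qed.

Lemma measurable_centered_mass_scaled c : measurable_fun [set: R] (fun t => mass (t / c)).
Proof.
rewrite (_ : (fun t => _) = EFin \o ((fun t => fine (mass t)) \o (fun t => t / c))); last first.
  by apply/funext => t /=; rewrite fineK.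
apply/measurable_EFinP; apply: measurableT_comp; first exact: measurable_fine_centered_mass.
exact: measurable_funM.
Qed.

End centered_mass_facts.

Section gamma_density.
Context {R : realType}.
Variables (gamma : R -> R) (gamma_nd : nondecreasing_on_nneg gamma).
Hypothesis gamma_ge0 : forall t : R, 0 <= t -> 0 <= gamma t.

Lemma dmeasure_sigma_finite : sigma_finite setT (dmeasure gamma_nd).
Proof. exact: (@sigma_finiteT _ _ _ (lebesgue_stieltjes_measure (stieltjes_fun gamma_nd))). Qed.

Lemma measurable_inve_gamma_dist (C tau : R) : 0 <= C ->
  measurable_fun [set: R] (fun t => ((gamma (C * `|t - tau|))%:E^-1)%E).
Proof.
move=> C0.
rewrite (_ : (fun t => _) = (fun t => ((ext0 gamma (C * `|t - tau|))%:E^-1)%E)); last first.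
  by apply/funext => t; rewrite ext0E// mulr_ge0.
apply: (@measurable_fun_inve_ge0 _ R R (fun t : R => ext0 gamma (C * `|t - tau|))).
  apply: (@measurableT_comp _ _ _ _ _ _ (ext0 gamma)).
    by apply: nondecreasing_measurable => //; exact: ext0_homo.
  apply: measurable_funM => //; apply: measurableT_comp => //.
  exact: measurable_funB.
by move=> t; exact: ext0_ge0.
Qed.

End gamma_density.

Section regular_of_fortunate.
Context {R : realType}.
Variables (gamma : R -> R) (gamma_nd : nondecreasing_on_nneg gamma).
Hypothesis gamma_ge0 : forall t : R, 0 <= t -> 0 <= gamma t.
Hypothesis gamma_gt0 : forall t : R, 0 < t -> 0 < gamma t.
Variables (mu : {measure set (measurableTypeR R) -> \bar R}) (tau : R).
Hypothesis mu_fin : forall t : R, centered_mass mu tau t \is a fin_num.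
Local Notation mass := (centered_mass mu tau).
Local Notation nu := (dmeasure gamma_nd).
Local Notation k := (inverse_density gamma).

(** At [0] the scaled augury is an upper limit, and the mass of the point [tau] is at
    most the mass of every centered interval. *)
Lemma centered_mass_le_scaled_augury (Phi : R -> R) (C M c eta : R) :
  0 < M -> 0 < c -> 0 < eta ->
  (forall s, 0 < s < eta -> fine (mass (s / c)) <= M * (s * Phi (C * s))) ->
  forall s, 0 <= s < eta -> (mass (s / c) <= M%:E * scaled_augury Phi C s)%E.
Proof.
move=> M0 c0 eta0 H s /andP[s0 se]; rewrite /scaled_augury; case: eqVneq => [->|sn0]; last first.
  by rewrite -(fineK (mu_fin _)) -EFinM lee_fin H// se lt_def sn0 s0.
rewrite mul0r -(fineK (mu_fin 0)).
have -> : (fine (mass 0))%:E = (M%:E * (fine (mass 0) / M)%:E)%E.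
  by rewrite -EFinM mulrC divfK// gt_eqF.
rewrite lee_wpmul2l ?lee_fin ?(ltW M0)// limf_esupE.
apply: le_ereal_inf_tmp => /= _ [V V0 <-].
have near_eta : \forall t \near 0^'+, 0 < t < eta.
  by near=> t; apply/andP; split => //; near: t; exact: nbhs_right_lt.
have [t [Vt /andP[t0 te]]] := filter_ex (filterI V0 near_eta).
apply: (@le_trans _ _ (t * Phi (C * t))%:E); last by apply: ereal_sup_ubound; exists t.
rewrite lee_fin ler_pdivrMr// mulrC; apply: le_trans (H t _); last by rewrite t0.
by apply: fine_centered_mass_le => //; rewrite divr_ge0// ltW.
Unshelve. all: by end_near. Qed.

(** Up to a bounded term, [1 / gamma] at the distance [c |x - tau|] is a tail integral of
    the inverse density. Exchanging the integrals leaves the integral of the mass of the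
    centered interval of radius [s / c], which the augury controls. *)
Lemma regular_of_mass_bound (Phi : R -> R) (C C0 M eta0 : R) :
  0 < C -> 0 < C0 -> 0 < M -> 0 < eta0 ->
  nu.-integrable `[0, 1[%classic (fun t => (scaled_augury Phi C0 t * k t)%E) ->
  (forall e, 0 < e < eta0 -> fine (mass (e / 2)) <= M * (e * Phi (C * e))) ->
  gamma_regular mu gamma tau.
Proof.
move=> C_0 C00 M0 eta00 /integrableP[msa intsa] Hm.
(* with this dilation the mass bound at radius [s / c] involves [Phi] at [C0 s], the
   argument that occurs in the augury *)
pose c := 2 * C / C0; have c0 : 0 < c by rewrite divr_gt0// mulr_gt0.
pose M1 := M * (C0 / C); have M10 : 0 < M1 by rewrite mulr_gt0// divr_gt0.
(* the bound 1 / 2 keeps `[0, eta[ inside the domain of integrability of the augury *)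
pose eta := Num.min (1 / 2) (eta0 * C / C0).
have eta0' : 0 < eta by rewrite lt_min !divr_gt0// mulr_gt0.
have eta1 : eta < 1 by rewrite gt_min ltr_pdivrMr// mul1r ltr1n.
have bound s : 0 <= s < eta -> (mass (s / c) <= M1%:E * scaled_augury Phi C0 s)%E.
  apply: centered_mass_le_scaled_augury => // {}s /andP[s0].
  rewrite lt_min => /andP[_ se].
  have e0 : 0 < s * C0 / C by rewrite divr_gt0// mulr_gt0.
  have := Hm (s * C0 / C); rewrite e0 ltr_pdivrMr// -ltr_pdivlMr// => /(_ se).
  have -> : s * C0 / C / 2 = s / c by rewrite /c; field; rewrite !gt_eqF.
  have -> : C * (s * C0 / C) = C0 * s by field; rewrite gt_eqF.
  by move=> h; apply: le_trans h _; rewrite /M1 le_eqVlt; apply/orP; left; apply/eqP; ring.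
have mk := measurable_inverse_density gamma_nd gamma_ge0.
have k0 := inverse_density_ge0 gamma_nd gamma_ge0.
have mm := measurable_centered_mass_scaled mu_fin c.
have finK : (\int[nu]_(s in `[0%R, eta[%classic) (k s * mass (s / c)) < +oo)%E.
  have sub : `[0, eta[%classic `<=` (`[0, 1[%classic : set R).
    by apply: subset_itv; rewrite bnd_simp// ltW.
  have msab : measurable_fun (`[0, 1[%classic : set (measurableTypeR R)) (fun t => `|scaled_augury Phi C0 t * k t|%E).
    exact: measurableT_comp.
  apply: (@le_lt_trans _ _ (\int[nu]_(s in `[0%R, eta[%classic) (M1%:E * `|scaled_augury Phi C0 s * k s|))%E).
    apply: ge0_le_integral => //.
    - by move=> s _; rewrite mule_ge0// measure_ge0.
    - by apply: measurable_funTS; exact: emeasurable_funM.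
    - by apply: measurable_funeM; apply: measurable_funS msab.
    - move=> s; rewrite /= in_itv/= => sI.
      apply: le_trans (lee_wpmul2l (k0 s) (bound _ sI)) _.
      rewrite muleCA lee_wpmul2l ?lee_fin ?(ltW M10)// muleC.
      exact: lee_abs.
  rewrite ge0_integralZl//; [|exact: measurable_funS msab|by rewrite lee_fin ltW].
  apply: lte_mul_pinfty; rewrite ?lee_fin ?ltW//.
  by apply: le_lt_trans intsa; exact: ge0_subset_integral.
exists c => //; pose U := `]tau - eta / c, tau + eta / c[%classic.
have ec0 : 0 < eta / c by rewrite divr_gt0.
exists U; first by split; [exact: interval_open|rewrite /U /= in_itv/= gtrBl ltrDl ec0].
have UP x : U x -> c * `|x - tau| < eta.
  rewrite /U /= in_itv/= => /andP[h1 h2].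
  rewrite mulrC -ltr_pdivlMr// ltr_norml; apply/andP; split; lra.
pose J x := (\int[nu]_(s in `[(c * `|x - tau|)%R, eta[%classic) k s)%E.
have mJ : measurable_fun [set: measurableTypeR R] J.
  by apply: measurable_tail_integral => //; exact: dmeasure_sigma_finite.
have J0 x : (0 <= J x)%E by apply: integral_ge0.
have Le0 := left_val_gt0 gamma_nd gamma_gt0 eta0'.
have mU : measurable (U : set (measurableTypeR R)) by exact: measurable_itv.
have gam0 x : (0 <= (gamma (c * `|x - tau|))%:E^-1)%E.
  by rewrite inve_ge0 lee_fin gamma_ge0// mulr_ge0// ltW.
have mgam := measurable_inve_gamma_dist gamma_nd gamma_ge0 tau (ltW c0).
apply/integrableP; split; first exact: measurable_funTS.
under eq_integral do rewrite gee0_abs//.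
have m2J : measurable_fun U (fun x => 2%:E * J x)%E.
  by apply: measurable_funTS; exact: measurable_funeM.
apply: (@le_lt_trans _ _ (\int[mu]_(x in U) ((left_val gamma eta)%:E^-1 + 2%:E * J x))%E).
  apply: ge0_le_integral => //.
  - exact: measurable_funTS.
  - by apply: emeasurable_funD.
  - move=> x Ux; have cx0 : 0 <= c * `|x - tau| by rewrite mulr_ge0// ltW.
    apply: le_trans (inve_left_val_le_integral gamma_nd gamma_ge0 gamma_gt0 cx0 (UP x Ux)).
    rewrite lee_pV2 ?inE ?lee_fin ?gamma_ge0 ?left_val_ge0//.
    by rewrite -(ext0E gamma cx0); exact: left_val_le_ext0.
have Linv0 : (0 <= (left_val gamma eta)%:E^-1)%E by rewrite inve_ge0 lee_fin ltW.
rewrite ge0_integralD//; last by move=> x _; rewrite mule_ge0.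
apply: lte_add_pinfty.
  rewrite integral_cst//= inver gt_eqF//; apply: lte_mul_pinfty => //.
    by rewrite lee_fin invr_ge0 ltW.
  apply: le_lt_trans (_ : mu U <= mass (eta / c))%E _; last by rewrite ltey_eq mu_fin.
  by apply: le_measure; rewrite ?inE//; exact: subset_itv_oo_cc.
apply: (@le_lt_trans _ _ (\int[mu]_x (2%:E * J x))%E).
  apply: ge0_subset_integral => //; first exact: measurable_funeM.
  by move=> x _; rewrite mule_ge0.
rewrite ge0_integralZl//; apply: lte_mul_pinfty => //.
rewrite (@layer_cake _ mu nu k tau c eta)//; last exact: dmeasure_sigma_finite.
by move=> t; rewrite ltey_eq mu_fin.
Qed.

End regular_of_fortunate.

(** * Construction of the heights *)

(** The integer part of [1 / lambda e] makes [lambda e] small and its fractional part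
    records [e], so [e] can be recovered from [lambda e]. *)
Lemma injective_below (R : realType) (m : R -> R) : (forall e, 0 < e -> 0 < m e) ->
  exists lambda : R -> R, (forall e, 0 < e -> 0 < lambda e < m e) /\
    (forall e e', 0 < e -> 0 < e' -> lambda e = lambda e' -> e = e').
Proof.
move=> m0; pose N e := Num.bound (m e)^-1; pose g (e : R) := e / (1 + e).
have g01 e : 0 < e -> 0 < g e < 1.
  move=> e0; have e1 : 0 < 1 + e by rewrite addr_gt0.
  by rewrite divr_gt0//= ltr_pdivrMr// mul1r ltrDr.
have Nm e : 0 < e -> (m e)^-1 < (N e)%:R.
  by move=> e0; apply: archi_boundP; rewrite invr_ge0 ltW// m0.
exists (fun e => ((N e)%:R + g e)^-1); split.
  move=> e e0; have /andP[g0 _] := g01 _ e0.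
  have Ng : (m e)^-1 < (N e)%:R + g e by apply: lt_trans (Nm _ e0) _; rewrite ltrDl.
  have mi0 : 0 < (m e)^-1 by rewrite invr_gt0 m0.
  have Np := lt_trans mi0 Ng.
  rewrite invr_gt0 Np/=; have -> : m e = ((m e)^-1)^-1 by rewrite invrK.
  by rewrite ltf_pV2 ?posrE.
move=> e e' e0 e'0 /invr_inj.
have /andP[g0 g1] := g01 _ e0; have /andP[g'0 g'1] := g01 _ e'0.
have NE : N e = N e' -> (N e)%:R + g e = (N e')%:R + g e' -> e = e'.
  have n1 (x : R) : 0 < x -> 1 + x != 0 by move=> x0; rewrite gt_eqF// addr_gt0.
  move=> -> /addrI /eqP; rewrite /g (eqr_div _ _ (n1 _ e0) (n1 _ e'0)) => /eqP.
  by rewrite !mulrDr !mulr1 [e' * e]mulrC => /addIr.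
have lt_N (a b : nat) (x y : R) : x < 1 -> 0 < y -> (a < b)%N -> a%:R + x != b%:R + y.
  move=> x1 y0 ab; rewrite lt_eqF//.
  apply: (@lt_le_trans _ _ (a.+1%:R)); first by rewrite -natr1 ltrD2l.
  by apply: (@le_trans _ _ b%:R); rewrite ?ler_nat// lerDl ltW.
have [lt|gt|/NE//] := ltngtP (N e) (N e').
  by move/eqP; rewrite (negbTE (lt_N _ _ _ _ g1 g'0 lt)).
by move/esym/eqP; rewrite (negbTE (lt_N _ _ _ _ g'1 g0 gt)).
Qed.

Section mass_at_point.
Context {R : realType}.
Variables (mu : {measure set (measurableTypeR R) -> \bar R}) (tau : R).
Hypothesis mu_fin : forall t : R, centered_mass mu tau t \is a fin_num.
Local Notation mass := (centered_mass mu tau).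

Lemma centered_mass_right_continuous0 (eps : R) : 0 < eps ->
  exists2 d : R, 0 < d & forall t, t < d -> fine (mass t) <= fine (mass 0) + eps.
Proof.
move=> eps0; pose F n := `[tau - n.+1%:R^-1, tau + n.+1%:R^-1]%classic.
have capF : \bigcap_n F n = `[tau - 0, tau + 0]%classic.
  rewrite subr0 addr0 set_itv1; apply/seteqP; split => [x Fx|x -> n _]; last first.
    by rewrite /F /= in_itv/= gerBl lerDl invr_ge0 ler0n.
  apply/eqP; rewrite -subr_eq0 -normr_le0; apply/ler_addgt0Pr => e e0; rewrite add0r.
  have [n _ nP] := near_infty_natSinv_lt (PosNum e0).
  have := Fx n I; rewrite /F /= in_itv/= => h.
  by apply: le_trans (ltW (nP n (leqnn n))); rewrite ler_distl.
have c : mu \o F @ \oo --> mass 0.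
  rewrite /centered_mass -capF; apply: nonincreasing_cvg_mu => //.
  - by rewrite ltey_eq (mu_fin 1%:R^-1).
  - by move=> n; exact: measurable_itv.
  - by rewrite capF.
  - move=> m n mn; apply/subsetPset; apply: subset_itv; rewrite bnd_simp ?lerD2l ?lerN2;
      by rewrite lef_pV2 ?posrE ?ler_nat.
have {}c : (fun n => fine (mass (n.+1%:R^-1))) @ \oo --> fine (mass 0).
  by apply: fine_cvg; rewrite fineK.
have /cvgrPdist_lt/(_ _ eps0)[n _ /(_ n (leqnn n)) nP] := c.
exists n.+1%:R^-1 => [|t td]; first by rewrite invr_gt0.
apply: (@le_trans _ _ (fine (mass n.+1%:R^-1))); first exact/fine_centered_mass_le/ltW.
by rewrite -lerBlDl ltW//; apply: le_lt_trans nP; rewrite distrC ler_norm.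
Qed.

End mass_at_point.

Section fortunate_of_regular.
Context {R : realType}.
Variables (f : R[i] -> R[i]) (mu : {measure set (measurableTypeR R) -> \bar R}) (tau : R).
Hypothesis f_analytic : analytic_on (@upper_half_plane R) f.
Hypothesis f_closed : maps_to_closed_half_plane f.
Hypothesis mu_f : nevanlinna_measure f mu.
Local Notation mass := (centered_mass mu tau).
Let mu_fin t : mass t \is a fin_num := centered_mass_fin tau mu_f t.

(** Any positive correction [w] leaves room for a height at which the horizontal
    integral is controlled by the mass; injectivity of [lambda] makes [Phi (2 t)] a
    function of [lambda t]. *)
Lemma fortunate_of_correction (w : R -> R) : (forall t, 0 < t -> 0 < w t) ->
  fortunate f (fun t => (fine (mass t) + w t) / t) tau.
Proof.
move=> w0; set Phi := (fun t => _).
have Phi0 t : 0 < t -> 0 < Phi t.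
  move=> t0; rewrite /Phi divr_gt0// ltr_wpDl ?w0//; exact: fine_centered_mass_ge0.
have two0 (e : R) : 0 < e -> 0 < 2 * e by move=> ?; rewrite mulr_gt0.
have /boolp.choice[l0 Hl0] : forall e : R, exists l0 : R, 0 < e -> 0 < l0 /\
    forall l, 0 < l < l0 ->
      horizontal_integral f tau e l <= 2 * (fine (mass (2 * e)) + w (2 * e)).
  move=> e.
  have [e0|e0] := ltP 0 e; last by exists 0.
  have [d d0 Hd] := horizontal_integral_le_centered_mass tau f_analytic f_closed mu_f e0 (w0 _ (two0 _ e0)).
  by exists d.
pose m e := Num.min (l0 e) (Num.min e (w (2 * e) * e / 2)).
have m0 e : 0 < e -> 0 < m e.
  by move=> e0; rewrite !lt_min e0 (Hl0 e e0).1/= divr_gt0// mulr_gt0// w0// two0.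
have [lambda [lm l_inj]] := injective_below m0.
have lp e : 0 < e -> 0 < lambda e by move=> /lm/andP[].
pose k l := if pselect (exists t, 0 < t /\ lambda t = l) is left H
            then Phi (2 * projT1 (cid H)) else 1.
have kl t : 0 < t -> k (lambda t) = Phi (2 * t).
  move=> t0; rewrite /k; case: pselect => [H|[]]; last by exists t.
  by case: cid => /= s [s0 /l_inj ->].
exists 2, k, lambda; split; split => //.
- move=> l _; rewrite /k; case: pselect => [H|_]//.
  by case: cid => /= t [t0 _]; rewrite Phi0// two0.
- by move=> t t0; rewrite kl.
- exists 1, 1; split => // t /= t0 _; rewrite mul1r.
  by have /andP[_ /ltW] := lm _ t0; rewrite !le_min => /and3P[].
- exists 1, 1; split => // e /= e0 _; rewrite mul1r.
  have P0 : 0 < Phi (2 * e) * e ^+ 2 by rewrite mulr_gt0 ?exprn_gt0 ?Phi0 ?two0.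
  rewrite ler_pdivrMr// mul1r.
  have /andP[_ /ltW] := lm _ e0; rewrite !le_min => /and3P[_ _ h]; apply: le_trans h _.
  have -> : Phi (2 * e) * e ^+ 2 = (fine (mass (2 * e)) + w (2 * e)) * e / 2.
    by rewrite /Phi; field; rewrite gt_eqF.
  rewrite ler_pM2r// ler_pM2r// lerDr; exact: fine_centered_mass_ge0.
- rewrite limf_esupE.
  have V0 : 0^'+ [set e : R | 0 < e] by exact: nbhs_right_gt.
  apply: (@le_lt_trans _ _ 2%:E); last exact: ltry.
  apply: ge_ereal_inf.
  exists (ereal_sup [set (Afk f k lambda tau e)%:E | e in [set e : R | 0 < e]]).
    by exists [set e : R | 0 < e].
  apply: ge_ereal_sup => _ [e /= e0 <-]; rewrite AfkE// ?lp// lee_fin.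
  have B0 : 0 < fine (mass (2 * e)) + w (2 * e).
    by rewrite ltr_wpDl ?w0 ?two0//; exact: fine_centered_mass_ge0.
  have -> : 2 * e * k (lambda e) = fine (mass (2 * e)) + w (2 * e).
    by rewrite kl// /Phi mulrC divfK// gt_eqF// two0.
  rewrite ler_pdivrMr//; apply: (Hl0 e e0).2.
  by have := lm _ e0; rewrite lt_min => /and3P[-> ->].
Qed.

End fortunate_of_regular.

(** * From regularity to an augury *)

Section augury_of_regular.
Context {R : realType}.
Variables (gamma : R -> R) (gamma_nd : nondecreasing_on_nneg gamma).
Hypothesis gamma_ge0 : forall t : R, 0 <= t -> 0 <= gamma t.
Hypothesis gamma_gt0 : forall t : R, 0 < t -> 0 < gamma t.
Variables (mu : {measure set (measurableTypeR R) -> \bar R}) (tau : R).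
Hypothesis mu_fin : forall t : R, centered_mass mu tau t \is a fin_num.
Local Notation mass := (centered_mass mu tau).
Local Notation nu := (dmeasure gamma_nd).
Local Notation L := (left_val gamma).
Local Notation k := (inverse_density gamma).
Variable c : R.
Hypothesis c0 : 0 < c.

(** Positive, so that [Phi] is positive even where [mu] has no mass, and so small that the
    integral of its dilate [w (s / c)] against the inverse density converges. *)
Definition augury_correction (t : R) : R := t * ext0 gamma (c * t / 2) ^+ 2.
Local Notation w := augury_correction.

Lemma augury_correction_gt0 t : 0 < t -> 0 < w t.
Proof.
move=> t0; have ct : 0 < c * t / 2 by rewrite divr_gt0// mulr_gt0.
by rewrite /w mulr_gt0// exprn_gt0// ext0E ?gamma_gt0// ltW.
Qed.

Let Phi t := (fine (mass t) + w t) / t.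
Let A s := c * fine (mass (s / c)) + s * ext0 gamma (s / 2) ^+ 2.

Let PhiE s : s != 0 -> s * Phi (c^-1 * s) = A s.
Proof.
move=> s0; rewrite /Phi /A /w [c^-1 * s]mulrC.
have -> : c * (s / c) / 2 = s / 2 by rewrite mulrCA divff ?mulr1// gt_eqF.
by field; rewrite s0 gt_eqF.
Qed.

Let A_ge0 s : 0 <= s -> 0 <= A s.
Proof.
move=> s0; rewrite /A addr_ge0//; last by rewrite mulr_ge0// exprn_ge0// ext0_ge0.
by rewrite mulr_ge0 ?(ltW c0)//; exact: fine_centered_mass_ge0.
Qed.

Let A0 : A 0 = c * fine (mass 0).
Proof. by rewrite /A !mul0r addr0. Qed.

(** Only the value at [0] needs an argument: the masses of the intervals shrinking to
    [tau] decrease to the mass of [tau]. *)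
Let scaled_augury_le s : 0 <= s -> (scaled_augury Phi c^-1 s <= (A s)%:E)%E.
Proof.
move=> s0; rewrite /scaled_augury; case: eqVneq => [->|sn0]; last by rewrite PhiE.
rewrite A0; apply/lee_addgt0Pr => eps eps0.
have e1 : 0 < eps / 2 / c by rewrite !divr_gt0.
have [d d0 Hd] := centered_mass_right_continuous0 mu_fin e1.
pose G := gamma 1 ^+ 2 + 1.
have G0 : 0 < G by rewrite ltr_wpDl// sqr_ge0.
pose d1 := Num.min (Num.min 1 (c * d)) (eps / 2 / G).
have d10 : 0 < d1 by rewrite !lt_min ltr01 mulr_gt0// !divr_gt0.
rewrite limf_esupE; apply: ge_ereal_inf.
exists (ereal_sup [set (t * Phi (c^-1 * t))%:E | t in [set t : R | 0 < t < d1]]).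
  exists [set t : R | 0 < t < d1] => //.
  near=> t; apply/andP; split => //; near: t; exact: nbhs_right_lt.
apply: ge_ereal_sup => _ [t /= /andP[t0 td] <-].
move: td; rewrite !lt_min => /andP[/andP[t1 tc] te].
rewrite PhiE ?gt_eqF// -EFinD lee_fin /A (splitr eps) addrA lerD//.
  have tcd : t / c < d by rewrite ltr_pdivrMr// mulrC.
  have -> : c * fine (mass 0) + eps / 2 = c * (fine (mass 0) + eps / 2 / c).
    by rewrite mulrDr; congr (_ + _); field; rewrite gt_eqF.
  by rewrite ler_pM2l// Hd.
have ge : ext0 gamma (t / 2) ^+ 2 <= G.
  rewrite /G; apply: (@le_trans _ _ (gamma 1 ^+ 2)); last by rewrite lerDl.
  have t20 : 0 <= t / 2 by rewrite divr_ge0// ltW.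
  apply: lerXn2r; rewrite ?nnegrE ?ext0_ge0 ?gamma_ge0//.
  by rewrite ext0E// gamma_nd// ler_pdivrMr// mul1r (le_trans (ltW t1))// ler1n.
apply: (@le_trans _ _ (t * G)); first by rewrite ler_pM2l.
by rewrite -ler_pdivlMr// ltW.
Unshelve. all: by end_near. Qed.

Let scaled_augury_ge0 s : 0 <= s -> (0 <= scaled_augury Phi c^-1 s)%E.
Proof.
move=> s0; rewrite /scaled_augury; case: eqVneq => [_|sn0]; last by rewrite PhiE// lee_fin A_ge0.
rewrite limf_esupE; apply: le_ereal_inf_tmp => /= _ [V V0 <-].
have [t [Vt t0]] := filter_ex (filterI V0 (nbhs_right_gt (0 : R))).
apply: (@le_trans _ _ (t * Phi (c^-1 * t))%:E); last by apply: ereal_sup_ubound; exists t.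
by rewrite PhiE ?gt_eqF// lee_fin A_ge0// ltW.
Qed.

Let measurable_A : measurable_fun [set: R] A.
Proof.
apply: measurable_funD; apply: measurable_funM => //.
  apply: (@measurableT_comp _ _ _ _ _ _ (fun t => fine (mass t))).
    exact: measurable_fine_centered_mass.
  exact: measurable_funM.
apply: measurable_funX; apply: (@measurableT_comp _ _ _ _ _ _ (ext0 gamma)); last exact: measurable_funM.
by apply: nondecreasing_measurable => //; exact: ext0_homo.
Qed.

Let measurable_scaled_augury : measurable_fun [set: R] (scaled_augury Phi c^-1).
Proof.
rewrite (_ : scaled_augury Phi c^-1 = (fun s => if s == 0 then
  limf_esup (fun s : R => (s * Phi (c^-1 * s))%:E) 0^'+ else (A s)%:E)); last first.
  by apply/funext => s; rewrite /scaled_augury; case: eqVneq => // s0; rewrite PhiE.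
apply: measurable_fun_ifT => //; last exact/measurable_EFinP.
by apply: measurable_fun_eqr.
Qed.

Let correction_density_le s : 0 <= s <= 1 ->
  ((s * ext0 gamma (s / 2) ^+ 2)%:E * k s <= 1)%E.
Proof.
move=> /andP[s0 s1]; have [->|sn0] := eqVneq s 0; first by rewrite mul0r mul0e.
have {}s0 : 0 < s by rewrite lt_def sn0.
have Ls0 := left_val_gt0 gamma_nd gamma_gt0 s0.
have gs0 := lt_le_trans Ls0 (left_val_le_right_val gamma_nd s).
have s2 : s / 2 < s by rewrite ltr_pdivrMr// ltr_pMr// ltr1n.
have h1 : ext0 gamma (s / 2) <= L s := ext0_le_left_val gamma_nd s2.
have h2 := le_trans h1 (left_val_le_right_val gamma_nd s).
rewrite inverse_densityE// -EFinM lee_fin ler_pdivrMr ?mulr_gt0// mul1r.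
apply: (@le_trans _ _ (1 * ext0 gamma (s / 2) ^+ 2)).
  by rewrite ler_wpM2r// exprn_ge0// ext0_ge0.
by rewrite mul1r expr2; apply: ler_pM => //; exact: ext0_ge0.
Qed.

(** The dilation by [c > C] absorbs the jumps of [gamma]; at [r = 0] both sides are
    the value [gamma 0], which extends [gamma] to the left. *)
Let gamma_le_left_val_scaled (C r : R) : 0 <= C -> C < c -> 0 <= r ->
  gamma (C * r) <= L (c * r).
Proof.
move=> C0 Cc; rewrite le_eqVlt => /predU1P[<-|r0].
  rewrite !mulr0; have -> : gamma 0 = ext0 gamma (-1).
    by rewrite /ext0 (max_idPr _)// lerN10.
  by apply: ext0_le_left_val => //; rewrite ltrN10.
rewrite -ext0E ?mulr_ge0 ?(ltW r0)//; apply: ext0_le_left_val => //.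
by rewrite ltr_pM2r.
Qed.

(** The same exchange of integrals as for the converse: the mass of the interval of
    radius [s / c], integrated against the inverse density, is the [mu]-integral of a tail
    integral, which is at most [2 / gamma (C |x - tau|)]. *)
Lemma augury_of_integrable (C : R) (U : set R) : 0 <= C -> C < c ->
  measurable (U : set (measurableTypeR R)) -> (forall x, c * `|x - tau| < 1 -> U x) ->
  mu.-integrable U (fun t => ((gamma (C * `|t - tau|))%:E^-1)%E) ->
  nu.-integrable `[0, 1[%classic (fun t => (scaled_augury Phi c^-1 t * k t)%E).
Proof.
move=> C0 Cc mU HU /integrableP[mgam intgam].
have mk := measurable_inverse_density gamma_nd gamma_ge0.
have k0 := inverse_density_ge0 gamma_nd gamma_ge0.
have mm := measurable_centered_mass_scaled mu_fin c.
have mD : measurable (`[0, 1[%classic : set (measurableTypeR R)) by exact: measurable_itv.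
apply/integrableP; split.
  by apply: measurable_funTS; exact: emeasurable_funM.
apply: (@le_lt_trans _ _ (\int[nu]_(s in `[0%R, 1%R[%classic)
    (c%:E * (k s * mass (s / c)) + cst 1%E s))%E).
  apply: ge0_le_integral => //.
  - apply: measurable_funTS; apply: measurableT_comp => //; exact: emeasurable_funM.
  - apply: measurable_funTS; apply: emeasurable_funD => //.
    by apply: measurable_funeM; exact: emeasurable_funM.
  - move=> s; rewrite /= in_itv/= => /andP[s0 s1].
    rewrite gee0_abs ?mule_ge0 ?scaled_augury_ge0//.
    apply: le_trans (lee_wpmul2r (k0 s) (scaled_augury_le s0)) _.
    rewrite /A EFinD ge0_muleDl; last 2 first.
    - by rewrite lee_fin mulr_ge0 ?fine_centered_mass_ge0// ltW.
    - by rewrite lee_fin; apply: mulr_ge0 => //; apply: exprn_ge0; exact: ext0_ge0.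
    apply: leeD; last by apply: correction_density_le; rewrite s0 ltW.
    by rewrite EFinM fineK// [X in (_ <= _ * X)%E]muleC muleA.
rewrite ge0_integralD//; last 2 first.
- by move=> s _; rewrite !mule_ge0 ?lee_fin ?(ltW c0) ?measure_ge0.
- by apply: measurable_funTS; apply: measurable_funeM; exact: emeasurable_funM.
apply: lte_add_pinfty; last first.
  rewrite integral_cst// mul1e.
  apply: (@le_lt_trans _ _ (nu `](-1)%R, 1%R]%classic)).
    by apply: le_measure; rewrite ?inE//; apply: subset_itv; rewrite bnd_simp ?ltrN10.
  by rewrite dmeasure_itvoc ?ltry// (le_trans (lerN10 _)).
rewrite ge0_integralZl//; first last.
- by rewrite lee_fin ltW.
- by move=> s _; rewrite mule_ge0// measure_ge0.
- by apply: measurable_funTS; exact: emeasurable_funM.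
apply: lte_mul_pinfty; rewrite ?lee_fin ?(ltW c0)//.
rewrite -(@layer_cake _ mu nu k tau c 1)//; last 2 first.
- by move=> t; rewrite ltey_eq mu_fin.
- exact: dmeasure_sigma_finite.
pose h (x : R) := ((gamma (C * `|x - tau|))%:E^-1)%E.
have h0 x : (0 <= h x)%E by rewrite inve_ge0 lee_fin gamma_ge0// mulr_ge0.
have {}intgam : (\int[mu]_(x in U) (2%:E * h x) < +oo)%E.
  rewrite ge0_integralZl//; apply: lte_mul_pinfty => //.
  by under eq_integral do rewrite -(gee0_abs (h0 _)).
apply: le_lt_trans intgam; rewrite [leRHS]integral_mkcond.
apply: ge0_le_integral => //.
- by move=> x _; apply: integral_ge0.
- by apply: measurable_tail_integral => //; exact: dmeasure_sigma_finite.
- apply/(measurable_restrictT _ _).1 => //; exact: measurable_funeM.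
move=> x _; rewrite patchE.
have cx0 : 0 <= c * `|x - tau| by rewrite mulr_ge0// ltW.
have [x1|x1] := ltP (c * `|x - tau|) 1; last first.
  rewrite set_itv_ge -?leNgt ?bnd_simp// integral_set0.
  by case: ifP => // _; rewrite mule_ge0.
rewrite mem_set; last exact: HU.
apply: le_trans (integral_inverse_density_le gamma_nd gamma_ge0 cx0 x1) _.
rewrite lee_wpmul2l// lee_pV2 ?inE ?lee_fin ?left_val_ge0 ?gamma_ge0 ?mulr_ge0//.
exact: gamma_le_left_val_scaled.
Qed.

End augury_of_regular.

Theorem theorem2p5 (R : realType) (gamma : R -> R)
    (gamma_ge0 : forall t : R, 0 <= t -> 0 <= gamma t)
    (gamma_gt0 : forall t : R, 0 < t -> 0 < gamma t)
    (gamma_nd : nondecreasing_on_nneg gamma)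
    (gamma_O1 : bigO_near0 [set t : R | 0 <= t] gamma (fun=> 1))
    (f : R[i] -> R[i])
    (f_analytic : analytic_on (@upper_half_plane R) f)
    (f_closed : maps_to_closed_half_plane f)
    (mu : {measure set (measurableTypeR R) -> \bar R})
    (mu_f : nevanlinna_measure f mu) (tau : R) :
  gamma_regular mu gamma tau <->
  exists Phi : R -> R,
    [/\ pos_fun Phi, gamma_augury gamma_nd Phi & fortunate f Phi tau].
Proof.
have mu_fin := centered_mass_fin tau mu_f.
split; last first.
  move=> [Phi [Phi0 [C0 C00 aug] fort]].
  have [C [M [eta [C_0 M0 eta0 H]]]] := fortunate_mass_bound f_analytic f_closed mu_f Phi0 fort.
  exact: (regular_of_mass_bound gamma_ge0 gamma_gt0 mu_fin C_0 C00 M0 eta0 aug H).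
move=> [C C0 [U [oU Utau] intU]].
have [d /= d0 dU] := open_nbhs_nbhs (conj oU Utau : open_nbhs tau U).
(* exceeding [C] absorbs the jumps of [gamma]; exceeding [1 / d] keeps the region
   [c |x - tau| < 1] inside [U] *)
pose c := C + 1 + d^-1.
have di0 : 0 < d^-1 by rewrite invr_gt0.
have Cc : C < c by rewrite /c -addrA ltrDl addr_gt0.
have c0 : 0 < c := lt_trans C0 Cc.
have w0 := augury_correction_gt0 gamma_gt0 c0.
exists (fun t => (fine (centered_mass mu tau t) + augury_correction gamma c t) / t); split.
- move=> t t0; rewrite divr_gt0// ltr_wpDl ?w0//; exact: fine_centered_mass_ge0.
- exists c^-1; first by rewrite invr_gt0.
  apply: (augury_of_integrable gamma_nd gamma_ge0 gamma_gt0 mu_fin c0 (ltW C0) Cc _ _ intU).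
    exact: open_measurable.
  move=> x xc; apply: dU => /=; rewrite distrC.
  have dc : d^-1 < c by rewrite /c ltrDr addr_gt0.
  have := lt_trans xc (_ : 1 < c * d); rewrite ltr_pM2l//; apply.
  by rewrite -ltr_pdivrMr// mul1r.
- exact: fortunate_of_correction.
Qed.
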